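(* Let $A\in\mathbb{R}^{m\times n}$, $B\in\mathbb{R}^{\nu\times n}$ with $B\neq 0$, $\sigma>0$, and let $\mathcal{X}=\{x\in\mathbb{R}^n:\exists t\in\mathcal{T}:\ x^TS_kx\le t_k,\ 1\le k\le K\}$ be an ellitope (with $S_k$, $\mathcal{T}$ as in the context). Let $(H_*,\lambda_* )$ be an optimal solution, and $\mathrm{Opt}$ the optimal value, of the convex optimization problem $$\mathrm{Opt}=\min_{H\in\mathbb{R}^{m\times\nu},\,\lambda\in\mathbb{R}^K}\Big\{\sigma^2\mathrm{Tr}(H^TH)+\phi_{\mathcal{T}}(\lambda):\ (B-H^TA)^T(B-H^TA)\preceq\sum_{k=1}^K\lambda_kS_k,\ \lambda\ge 0\Big\}.$$ Then the linear estimate $\widehat{w}_{H_*}(\omega)=H_*^T\omega$ satisfies $$\mathrm{Risk}[\widehat{w}_{H_*}|\mathcal{X}]\ \le\ \sqrt{\mathrm{Opt}}\ \le\ \sqrt{6\ln\left(\frac{8M_*^2K}{\mathrm{Risk}_{\mathrm{opt}}^2[\mathcal{X}]}\right)}\ \mathrm{Risk}_{\mathrm{opt}}[\mathcal{X}],$$ where $M_*=\sqrt{\max_{Q\in\mathcal{Q}}\mathrm{Tr}(BQB^T)}$.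
   Context: Ellitope data: $S_1,\dots,S_K$ are symmetric positive semidefinite $n\times n$ matrices with $\sum_kS_k\succ0$; $\mathcal{T}\subset\mathbb{R}^K_+$ is a nonempty convex compact set which intersects the interior of $\mathbb{R}^K_+$ and is monotone ($0\le\tau\le t$ and $t\in\mathcal{T}$ imply $\tau\in\mathcal{T}$). Here $\succeq$ is the positive semidefinite order. $\phi_{\mathcal{T}}(\lambda)=\max_{t\in\mathcal{T}}\lambda^Tt$ is the support function of $\mathcal{T}$. $\mathcal{Q}=\{Q\in\mathbb{R}^{n\times n}\text{ symmetric}: Q\succeq0,\ \exists t\in\mathcal{T}:\ \mathrm{Tr}(QS_k)\le t_k,\ 1\le k\le K\}$ (a convex compact set). Observation model: $\omega=Ax+\sigma\xi$, $\xi\sim\mathcal{N}(0,I_m)$, with unknown $x\in\mathcal{X}$; the goal is to estimate $Bx$. An estimate is a Borel function $\widehat{w}:\mathbb{R}^m\to\mathbb{R}^\nu$; its risk is $$\mathrm{Risk}[\widehat{w}|\mathcal{X}]=\sup_{x\in\mathcal{X}}\Big[\mathbf{E}_{\xi\sim\mathcal{N}(0,I_m)}\{\|\widehat{w}(Ax+\sigma\xi)-Bx\|_2^2\}\Big]^{1/2},$$ and $\mathrm{Risk}_{\mathrm{opt}}[\mathcal{X}]=\inf_{\widehat{w}(\cdot)}\mathrm{Risk}[\widehat{w}|\mathcal{X}]$, the infimum being over all Borel estimates. *)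

(* Defs.v *)
From HB Require Import structures.
From mathcomp Require Import all_boot all_order all_algebra.
From mathcomp Require Import all_classical all_reals all_analysis.
From mathcomp Require Import measurable_realfun lra.

Set Implicit Arguments.
Unset Strict Implicit.
Unset Printing Implicit Defensive.

Import Order.TTheory GRing.Theory Num.Theory.
Import numFieldNormedType.Exports.

Local Open Scope classical_set_scope.
Local Open Scope ring_scope.

(* Vectors of R^n are column vectors 'cV[R]_n.  Matrices carry the Borel
   sigma-algebra, generated by the open sets of the library's topology. *)
HB.instance Definition _ (R : realType) (m n : nat) :=
  @isMeasurable.Build (sigma_display (@open 'M[R]_(m, n))) 'M[R]_(m, n)
    <<s open >> (@sigma_algebra0 _ setT open) (@sigma_algebraC _ open)
    (@sigma_algebra_bigcup _ setT open).

Lemma open_measurable_mx (R : realType) m n (U : set 'M[R]_(m, n)) :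
  open U -> measurable U.
Proof. by move=> oU; exact: sub_sigma_algebra. Qed.

Lemma measurable_mx_coord (R : realType) m n i j :
  measurable_fun setT (fun M : 'M[R]_(m, n) => M i j).
Proof.
apply: (measurability _ (RGenOpens.measurableE R)).
move=> _ [_ [a [b ->] <-]]; rewrite setTI; apply: open_measurable_mx.
by apply: open_comp; [move=> M _; exact: coord_continuous|exact: interval_open].
Qed.

Definition rat_mx_ball (R : realType) m n (p : 'M[rat]_(m, n) * nat) :
  set 'M[R]_(m, n) := ball (map_mx (@ratr R) p.1) p.2.+1%:R^-1.

Lemma open_bigcup_rat_mx (R : realType) m n (U : set 'M[R]_(m, n)) : open U ->
  U = \bigcup_(p in [set p | rat_mx_ball (R := R) p `<=` U]) rat_mx_ball p.
Proof.
move=> oU; apply/seteqP; split=> [M UM|M [p pU]]; last exact: pU.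
have : nbhs M U by apply: open_nbhs_nbhs.
rewrite -nbhs_ballE => -[_/posnumP[e] eU].
have [N _ /(_ N (leqnn N)) Ne] := near_infty_natSinv_lt (e%:num / 2)%:pos.
pose d : R := N.+1%:R^-1; have d0 : 0 < d by rewrite invr_gt0.
have /choice[q qP] : forall ij : 'I_m * 'I_n, exists q : rat,
    ratr q \in `]M ij.1 ij.2 - d, M ij.1 ij.2 + d[.
  move=> ij; apply: rat_in_itvoo.
  by lra.
pose Q := \matrix_(i, j) q (i, j).
have QM : rat_mx_ball (Q, N) M.
  split=> // i j; rewrite !mxE -ball_normE /= -/d.
  have := qP (i, j); rewrite /= in_itv/= => /andP[q1 q2].
  by rewrite ltr_norml; lra.
exists (Q, N) => //= M' QM'; apply: eU; rewrite /= [e%:num]splitr.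
apply: (@ball_triangle _ 'M[R]_(m, n) (map_mx (@ratr R) Q)).
- by apply: ball_sym; apply: le_ball QM; exact: ltW.
- by apply: le_ball QM'; exact: ltW.
Qed.

Lemma measurable_fun_mxP (R : realType) m n d (T : measurableType d)
    (f : T -> 'M[R]_(m, n)) :
  measurable_fun setT f <->
  forall i j, measurable_fun setT (fun x => f x i j).
Proof.
split=> [mf i j|mf].
  exact: (measurableT_comp (@measurable_mx_coord R m n i j) mf).
apply: (@measurability _ _ _ _ setT f (@open 'M[R]_(m, n))) => // _ [U oU <-].
rewrite setTI (open_bigcup_rat_mx oU) preimage_bigcup bigcup_mkcond.
apply: countable_bigcupT_measurable => [|p]; first exact: countableP.
case: ifP => // _.
rewrite (_ : _ @^-1` _ = \bigcap_(ij in [set: 'I_m * 'I_n])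
  (fun x => f x ij.1 ij.2) @^-1` ball (@ratr R (p.1 ij.1 ij.2)) p.2.+1%:R^-1).
  apply: fin_bigcap_measurable => // -[i j] _.
  rewrite -[X in measurable X]setTI; apply: mf => //.
  by apply: open_measurable; exact: ball_open.
apply/seteqP; split=> [x [_ +] [i j] _|x Hx].
  by move=> /(_ i j); rewrite mxE.
by split=> // i j; rewrite mxE; exact: (Hx (i, j)).
Qed.

Definition cV_cons (R : realType) m (p : measurableTypeR R * 'cV[R]_m) : 'cV[R]_m.+1 :=
  col_mx (p.1%:M : 'M[R]_1) p.2.

Lemma cV_cons0 (R : realType) m (p : R * 'cV[R]_m) : cV_cons p ord0 0 = p.1.
Proof.
rewrite /cV_cons (_ : ord0 = lshift m (0 : 'I_1)); last exact: val_inj.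
by apply: etrans (col_mxEu (p.1%:M : 'M[R]_1) p.2 0 0) _; rewrite mxE.
Qed.

Lemma cV_consS (R : realType) m (p : R * 'cV[R]_m) i :
  cV_cons p (lift ord0 i) 0 = p.2 i 0.
Proof.
rewrite /cV_cons (_ : lift ord0 i = rshift 1 i); last exact: val_inj.
exact: (col_mxEd (p.1%:M : 'M[R]_1) p.2 i 0).
Qed.

Lemma measurable_cV_cons (R : realType) m :
  measurable_fun setT (@cV_cons R m).
Proof.
apply/measurable_fun_mxP => i j; rewrite (ord1 j) {j}.
have [->|] := eqVneq i ord0.
  by rewrite (_ : (fun _ => _) = fst)//; apply/funext => p; rewrite cV_cons0.
rewrite eq_sym => /unlift_some[k -> _].
rewrite (_ : (fun _ => _) = (fun y : 'cV[R]_m => y k 0) \o snd); last first.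
  by apply/funext => p; rewrite cV_consS.
exact: (measurableT_comp (@measurable_mx_coord R m 1 k 0)).
Qed.

HB.instance Definition _ (R : realType) m :=
  isMeasurableFun.Build _ _ _ _ (@cV_cons R m) (@measurable_cV_cons R m).

(* N(0, I_m): the product of m copies of N(0, 1); see std_normal_box. *)
Fixpoint std_normal (R : realType) m : probability 'cV[R]_m R :=
  if m is m'.+1
  then distribution (normal_prob 0 1 \x std_normal R m')%E (@cV_cons R m')
  else dirac (0 : 'cV[R]_0).

Lemma measurable_box (R : realType) m (D : 'I_m -> set R) :
  (forall i, measurable (D i)) ->
  measurable [set x : 'cV[R]_m | forall i, D i (x i 0)].
Proof.
move=> mD; rewrite (_ : mkset _ =
  \bigcap_(i in [set: 'I_m]) (fun x : 'cV[R]_m => x i 0) @^-1` D i); last first.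
  by apply/seteqP; split=> x /= Dx i; [move=> _; exact: Dx|exact: (Dx i)].
apply: fin_bigcap_measurable => // i _; rewrite -[X in measurable X]setTI.
exact: (@measurable_mx_coord R m 1 i 0).
Qed.

Lemma std_normal_box (R : realType) m (D : 'I_m -> set R) :
  (forall i, measurable (D i)) ->
  std_normal R m [set x | forall i, D i (x i 0)] =
  (\prod_(i < m) normal_prob 0 1 (D i))%E.
Proof.
elim: m D => [|m IH] D mD.
  rewrite big_ord0 /= diracE mem_set//=.
  by case.
rewrite big_ord_recl -IH //= /distribution /pushforward.
have mbox := measurable_box (fun i => mD (lift ord0 i)).
apply: etrans (product_measure1E
  (normal_prob 0 1) (std_normal R m) (mD ord0) mbox).
congr (_ _); apply/seteqP; split=> -[a x] /=.
  move=> Dax; split=> [|i]; first by have := Dax ord0; rewrite cV_cons0.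
  by have := Dax (lift ord0 i); rewrite cV_consS.
move=> [Da Dx] i; have [->|] := eqVneq i ord0; first by rewrite cV_cons0.
by rewrite eq_sym => /unlift_some[k -> _]; rewrite cV_consS; exact: Dx.
Qed.

(* The library's norm on matrices is the sup norm, so the Euclidean norm is
   written out. *)
Definition sqnorm2 (R : realType) n (v : 'cV[R]_n) : R := \sum_i v i 0 ^+ 2.

Definition psdmx (R : realType) n (M : 'M[R]_n) :=
  M \is symmetricmx /\ forall x : 'cV[R]_n, 0 <= (x^T *m M *m x) 0 0.

Definition pdmx (R : realType) n (M : 'M[R]_n) :=
  M \is symmetricmx /\ forall x : 'cV[R]_n, x != 0 -> 0 < (x^T *m M *m x) 0 0.

Definition loewner_le (R : realType) n (M N : 'M[R]_n) := psdmx (N - M).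

Definition nonneg_orthant (R : realType) K : set 'cV[R]_K :=
  [set t | forall k, 0 <= t k 0].

Record ellitope_data (R : realType) n K
    (S : 'I_K -> 'M[R]_n) (T : set 'cV[R]_K) : Prop := {
  ellitope_psd : forall k, psdmx (S k);
  ellitope_pd : pdmx (\sum_k S k);
  ellitope_orthant : T `<=` @nonneg_orthant R K;
  ellitope_nonempty : T !=set0;
  ellitope_convex : convex_set T;
  ellitope_compact : compact T;
  ellitope_interior : T `&` (@nonneg_orthant R K)° !=set0;
  ellitope_monotone : forall tau t : 'cV[R]_K,
    (forall k, 0 <= tau k 0 <= t k 0) -> T t -> T tau
}.

Definition ellitope (R : realType) n K
    (S : 'I_K -> 'M[R]_n) (T : set 'cV[R]_K) : set 'cV[R]_n :=
  [set x | exists2 t, T t & forall k, (x^T *m S k *m x) 0 0 <= t k 0].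

Definition matrix_ellitope (R : realType) n K
    (S : 'I_K -> 'M[R]_n) (T : set 'cV[R]_K) : set 'M[R]_n :=
  [set Q | psdmx Q /\ exists2 t, T t & forall k, \tr (Q *m S k) <= t k 0].

(* Maxima and minima over compact or attained families are written as the
   library's total sup and inf on R. *)
Definition support_fun (R : realType) K (T : set 'cV[R]_K) (l : 'cV[R]_K) : R :=
  sup [set (l^T *m t) 0 0 | t in T].

Definition Mstar (R : realType) n nu K (B : 'M[R]_(nu, n))
    (S : 'I_K -> 'M[R]_n) (T : set 'cV[R]_K) : R :=
  Num.sqrt (sup [set \tr (B *m Q *m B^T) | Q in matrix_ellitope S T]).

Section design_problem.
Context (R : realType) (m n nu K : nat).
Variables (A : 'M[R]_(m, n)) (B : 'M[R]_(nu, n)) (sigma : R).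
Variables (S : 'I_K -> 'M[R]_n) (T : set 'cV[R]_K).
Implicit Types p : 'M[R]_(m, nu) * 'cV[R]_K.

Definition design_objective p : R :=
  sigma ^+ 2 * \tr (p.1^T *m p.1) + support_fun T p.2.

Definition design_feasible : set ('M[R]_(m, nu) * 'cV[R]_K) :=
  [set p : 'M[R]_(m, nu) * 'cV[R]_K |
    loewner_le ((B - p.1^T *m A)^T *m (B - p.1^T *m A))
               (\sum_k p.2 k 0 *: S k)
    /\ forall k, 0 <= p.2 k 0].

Definition design_optimal p :=
  design_feasible p /\
  forall q, design_feasible q -> design_objective p <= design_objective q.

Definition design_opt : R := inf [set design_objective p | p in design_feasible].

End design_problem.

Section estimation.
Context (R : realType) (m n nu : nat).
Variables (A : 'M[R]_(m, n)) (B : 'M[R]_(nu, n)) (sigma : R).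
Variable X : set 'cV[R]_n.

Definition risk (w : 'cV[R]_m -> 'cV[R]_nu) : \bar R :=
  ereal_sup [set sqrte ('E_(std_normal R m)
    [fun xi : 'cV[R]_m => sqnorm2 (w (A *m x + sigma *: xi) - B *m x)])
  | x in X].

Definition risk_opt : \bar R :=
  ereal_inf [set risk w | w in [set w | measurable_fun setT w]].

End estimation.

Definition linear_estimate (R : realType) m nu (H : 'M[R]_(m, nu))
    (omega : 'cV[R]_m) : 'cV[R]_nu := H^T *m omega.

(* Main.v *)
(* By conic duality, for every [eps > 0] there is a covariance [Q] in the matrix
   ellitope such that no linear estimate has Bayes risk below [Opt - eps] under
   a centred prior with covariance [Q].  Under a Gaussian prior the posterior is
   symmetric about its mean, which is linear in the observation, so the same
   lower bound holds for all estimates.  The Gaussian prior [N(0, Q / (4 L))]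
   violates a given constraint of the ellitope with probability of order
   [expR (- L)]; as an estimate may be projected onto the ball of radius
   [Mstar], which contains the image of the ellitope under [B], the signals
   outside the ellitope contribute at most [4 K Mstar^2 expR (- L)] to the Bayes
   risk.  Hence [Opt / (4 L) <= Ropt^2 + 4 K Mstar^2 expR (- L)] for [L >= 2], and
   [L = ln (8 Mstar^2 K / Ropt^2)] makes the last term [Ropt^2 / 2]. *)

Require Import Defs.
From HB Require Import structures.
From mathcomp Require Import all_boot all_order all_algebra.
From mathcomp Require Import all_classical all_reals all_analysis.
From mathcomp Require Import measurable_realfun ring lra.

Set Implicit Arguments.
Unset Strict Implicit.
Unset Printing Implicit Defensive.

Import Order.TTheory GRing.Theory Num.Theory.
Import numFieldNormedType.Exports.

Local Open Scope classical_set_scope.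
Local Open Scope ring_scope.

(** * Positive semidefinite matrices *)

(** The prior may be degenerate, so it is realised as the image of [N(0, I)] under a factor [G] of
    its covariance. No conditional law is constructed: a Cameron-Martin change of measure makes the
    observation independent of the signal at the price of a weight, and the posterior symmetry
    becomes the invariance of a joint integral under a reflection. The probability of leaving the
    ellitope and the size of the loss there are bounded together, through the exponential of one
    quadratic form. The factor [1 / (4 L)] is tuned to it: the part of the form that detects the
    violation has mean at most [1/4], the part that absorbs the loss at most [1/8], and
    [(1 - 2 * 3/8)^(-1/2) = 2]. The constant 6 is [4 (1 + 1/2)]. Attainment is established neither
    for the dual problem nor for the infimum over estimates; both enter with a slack that tends to
    0. If [Ropt = 0] the choice of [L] through the logarithm breaks down, and letting [L] grow shows
    [Opt = 0]. *)

Section dot.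
Context (R : realType) (n : nat).
Implicit Types x y z : 'cV[R]_n.

Lemma dotE x y : (x^T *m y) 0 0 = \sum_k x k 0 * y k 0.
Proof. by rewrite mxE; apply: eq_bigr => k _; rewrite mxE. Qed.

Lemma dotC x y : (x^T *m y) 0 0 = (y^T *m x) 0 0.
Proof. by rewrite !dotE; apply: eq_bigr => k _; rewrite mulrC. Qed.

Lemma dotDr x y z : (x^T *m (y + z)) 0 0 = (x^T *m y) 0 0 + (x^T *m z) 0 0.
Proof. by rewrite mulmxDr mxE. Qed.

Lemma dotDl x y z : ((x + y)^T *m z) 0 0 = (x^T *m z) 0 0 + (y^T *m z) 0 0.
Proof. by rewrite linearD/= mulmxDl mxE. Qed.

Lemma dotNr x y : (x^T *m - y) 0 0 = - (x^T *m y) 0 0.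
Proof. by rewrite mulmxN mxE. Qed.

Lemma dotNl x y : ((- x)^T *m y) 0 0 = - (x^T *m y) 0 0.
Proof. by rewrite linearN/= mulNmx mxE. Qed.

Lemma dotZr (a : R) x y : (x^T *m (a *: y)) 0 0 = a * (x^T *m y) 0 0.
Proof. by rewrite -scalemxAr mxE. Qed.

Lemma dotZl (a : R) x y : ((a *: x)^T *m y) 0 0 = a * (x^T *m y) 0 0.
Proof.
have -> : (a *: x)^T = a *: x^T by rewrite linearZ.
by rewrite -scalemxAl mxE.
Qed.

End dot.

Section psd.
Context (R : realType).
Implicit Types n p q : nat.

Lemma symmetricmxP n (M : 'M[R]_n) : reflect (M^T = M) (M \is symmetricmx).
Proof.
rewrite qualifE/= expr0 scale1r map_mx_id//.
by apply: (iffP eqP) => /esym.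
Qed.

Definition qform n (M : 'M[R]_n) (x : 'cV[R]_n) : R := (x^T *m M *m x) 0 0.

Lemma qformD n (M N : 'M[R]_n) x : qform (M + N) x = qform M x + qform N x.
Proof. by rewrite /qform mulmxDr mulmxDl mxE. Qed.

Lemma qformZ n a (M : 'M[R]_n) x : qform (a *: M) x = a * qform M x.
Proof. by rewrite /qform -scalemxAr -scalemxAl mxE. Qed.

Lemma qformN n (M : 'M[R]_n) x : qform (- M) x = - qform M x.
Proof. by rewrite -scaleN1r qformZ mulN1r. Qed.

Lemma qform_sum n (I : finType) (M : I -> 'M[R]_n) x :
  qform (\sum_i M i) x = \sum_i qform (M i) x.
Proof. by rewrite /qform mulmx_sumr mulmx_suml summxE. Qed.

Lemma sqnorm2E n (x : 'cV[R]_n) : sqnorm2 x = (x^T *m x) 0 0.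
Proof. by rewrite mxE; apply: eq_bigr => i _; rewrite mxE. Qed.

Lemma sqnorm2_ge0 n (x : 'cV[R]_n) : 0 <= sqnorm2 x.
Proof. by apply: sumr_ge0 => i _; exact: sqr_ge0. Qed.

Lemma sqnorm2_eq0 n (x : 'cV[R]_n) : sqnorm2 x = 0 -> x = 0.
Proof.
move=> x0; apply/matrixP => i j; rewrite (ord1 j) mxE; apply/eqP.
rewrite -sqrf_eq0; apply/eqP; move: i (erefl true) => i _.
by apply: (psumr_eq0P _ x0) => // k _; exact: sqr_ge0.
Qed.

Lemma sqnorm2Z n a (x : 'cV[R]_n) : sqnorm2 (a *: x) = a ^+ 2 * sqnorm2 x.
Proof. by rewrite /sqnorm2 mulr_sumr; apply: eq_bigr => i _; rewrite mxE exprMn. Qed.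

Lemma sqnorm2N n (x : 'cV[R]_n) : sqnorm2 (- x) = sqnorm2 x.
Proof. by apply: eq_bigr => i _; rewrite mxE sqrrN. Qed.

Lemma sqnorm2D n (x y : 'cV[R]_n) :
  sqnorm2 (x + y) = sqnorm2 x + 2 * (x^T *m y) 0 0 + sqnorm2 y.
Proof.
rewrite /sqnorm2 mxE mulr_sumr -!big_split/=; apply: eq_bigr => i _.
by rewrite !mxE; ring.
Qed.

Lemma sqnorm2_mul n p (N : 'M[R]_(p, n)) x :
  sqnorm2 (N *m x) = qform (N^T *m N) x.
Proof. by rewrite sqnorm2E /qform trmx_mul !mulmxA. Qed.

Lemma psdmx_sym n (M : 'M[R]_n) : psdmx M -> M^T = M.
Proof. by case=> /symmetricmxP. Qed.

Lemma psdmx_gram n p (N : 'M[R]_(p, n)) : psdmx (N^T *m N).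
Proof.
split=> [|x]; first by apply/symmetricmxP; rewrite trmx_mul trmxK.
by rewrite -/(qform _ _) -sqnorm2_mul sqnorm2_ge0.
Qed.

Lemma psdmxD n (M N : 'M[R]_n) : psdmx M -> psdmx N -> psdmx (M + N).
Proof.
move=> [/symmetricmxP sM pM] [/symmetricmxP sN pN].
split; first by apply/symmetricmxP; rewrite linearD/= sM sN.
by move=> x; rewrite -/(qform _ _) qformD addr_ge0 ?pM ?pN.
Qed.

Lemma psdmxZ n a (M : 'M[R]_n) : 0 <= a -> psdmx M -> psdmx (a *: M).
Proof.
move=> a0 [/symmetricmxP sM pM].
split; first by apply/symmetricmxP; rewrite linearZ/= sM.
by move=> x; rewrite -/(qform _ _) qformZ mulr_ge0 ?pM.
Qed.

Lemma psdmx0 n : psdmx (0 : 'M[R]_n).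
Proof.
by split=> [|x]; [apply/symmetricmxP; rewrite trmx0 | rewrite mulmx0 mul0mx mxE].
Qed.

Lemma psdmx_sum n (I : finType) (M : I -> 'M[R]_n) :
  (forall i, psdmx (M i)) -> psdmx (\sum_i M i).
Proof.
move=> pM; elim/big_ind: _ => // [|? ?]; [exact: psdmx0|exact: psdmxD].
Qed.

Lemma psdmx_congr n p (M : 'M[R]_n) (G : 'M[R]_(n, p)) :
  psdmx M -> psdmx (G^T *m M *m G).
Proof.
move=> [/symmetricmxP sM pM]; split=> [|x].
  by apply/symmetricmxP; rewrite !trmx_mul trmxK sM mulmxA.
by have := pM (G *m x); rewrite trmx_mul !mulmxA.
Qed.

Lemma qform_block n (a : R) (b : 'cV[R]_n) (M : 'M[R]_n) c y :
  qform (block_mx a%:M b^T b M : 'M[R]_(1 + n)) (col_mx c%:M y) =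
  c ^+ 2 * a + 2 * c * (b^T *m y) 0 0 + qform M y.
Proof.
rewrite /qform tr_col_mx mul_row_block mul_row_col !mulmxDl tr_scalar_mx.
have -> : y^T *m b = (b^T *m y)^T by rewrite trmx_mul trmxK.
rewrite !mul_scalar_mx !mul_mx_scalar -!scalemxAl !mxE eqxx mulr1n.
by ring.
Qed.

(** Induction on the size through the Schur complement of the corner entry [a]. The same block
    formula serves a zero pivot: then [b = 0], and [a^-1] and [s^-1] are 0 by convention. *)
Lemma psdmx_factor n (M : 'M[R]_n) :
  psdmx M -> exists F : 'M[R]_n, M = F^T *m F.
Proof.
elim: n M => [|n IH] M; first by exists 0; rewrite [LHS]flatmx0 [RHS]flatmx0.
rewrite -[n.+1]/(1 + n)%N in M * => -[/symmetricmxP sM pM].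
pose a := M 0 0; pose b := dlsubmx M; pose M' := drsubmx M.
have aE : ulsubmx M = a%:M.
  rewrite [LHS]mx11_scalar; congr _%:M; rewrite !mxE /a.
  by congr (M _ _); apply: val_inj.
have bE : ursubmx M = b^T by rewrite /b trmx_dlsub sM.
have ME : M = block_mx a%:M b^T b M' by rewrite -aE -bE submxK.
have sM' : M'^T = M' by rewrite /M' trmx_drsub sM.
have q c y : 0 <= c ^+ 2 * a + 2 * c * (b^T *m y) 0 0 + qform M' y.
  by rewrite -qform_block -ME; exact: pM.
have a0 : 0 <= a.
  have := q 1 0; rewrite /qform !mulmx0 !mxE; lra.
have b0 : a = 0 -> b = 0.
  move=> aeq; apply: sqnorm2_eq0; apply/eqP; rewrite eq_le sqnorm2_ge0 andbT.
  rewrite leNgt; apply/negP => bgt0.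
  (* With this scalar the linear term is [- (qform M' b + 1)], so the form would take the value
     [-1]. *)
  have := q (- (qform M' b + 1) / (2 * sqnorm2 b)) b.
  rewrite aeq -sqnorm2E mulr0 add0r.
  have -> : 2 * (- (qform M' b + 1) / (2 * sqnorm2 b)) * sqnorm2 b =
    - (qform M' b + 1) by field; rewrite gt_eqF.
  lra.
have qbb (y : 'cV[R]_n) : qform (b *m b^T) y = (b^T *m y) 0 0 ^+ 2.
  rewrite /qform mulmxA -mulmxA.
  have -> : y^T *m b = (b^T *m y)^T by rewrite trmx_mul trmxK.
  by rewrite [LHS]mxE big_ord1 !mxE expr2.
have psdS : psdmx (M' - a^-1 *: (b *m b^T)).
  split=> [|y].
    by apply/symmetricmxP; rewrite linearB linearZ/= trmx_mul trmxK sM'.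
  rewrite -/(qform _ _) qformD qformN qformZ qbb.
  have [aeq|aneq] := eqVneq a 0.
    by have := q 0 y; rewrite aeq invr0; lra.
  have := q (- (b^T *m y) 0 0 / a) y.
  set t := (b^T *m y) 0 0; set u := qform _ _.
  have -> : (- t / a) ^+ 2 * a + 2 * (- t / a) * t + u = u - a^-1 * t ^+ 2.
    by field.
  by [].
have [F' FE] := IH _ psdS.
pose s := Num.sqrt a.
have ss : s * s = a by rewrite -expr2 sqr_sqrtr.
exists (block_mx s%:M (s^-1 *: b^T) 0 F' : 'M[R]_(1 + n)).
rewrite ME tr_block_mx mulmx_block !trmx0 !mul0mx !addr0 tr_scalar_mx.
have sb : (s * s^-1) *: b = b.
  have [aeq|aneq] := eqVneq a 0; first by rewrite b0// scaler0.
  by rewrite divff ?scale1r// sqrtr_eq0 -ltNge lt_def aneq.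
have -> : (s^-1 *: b^T)^T = s^-1 *: b by rewrite linearZ/= trmxK.
rewrite -scalar_mxM ss !mul_scalar_mx mul_mx_scalar scalerA -linearZ/= sb.
rewrite scalerA sb mulmx0 addr0.
by rewrite -scalemxAl -scalemxAr scalerA -FE -invfM ss addrC subrK.
Qed.

Lemma mxtrace_gram n p (N : 'M[R]_(p, n)) :
  \tr (N^T *m N) = \sum_j sqnorm2 (col j N).
Proof.
apply: eq_bigr => j _; rewrite !mxE /sqnorm2.
by apply: eq_bigr => i _; rewrite !mxE expr2.
Qed.

Lemma mxtrace_gram_ge0 n p (N : 'M[R]_(p, n)) : 0 <= \tr (N^T *m N).
Proof. by rewrite mxtrace_gram; apply: sumr_ge0 => j _; exact: sqnorm2_ge0. Qed.

Lemma mxtrace_gram_eq0 n p (N : 'M[R]_(p, n)) : \tr (N^T *m N) = 0 -> N = 0.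
Proof.
rewrite mxtrace_gram => N0; apply/matrixP => i j; rewrite mxE.
have /sqnorm2_eq0/matrixP/(_ i 0) : sqnorm2 (col j N) = 0.
  by apply: (psumr_eq0P _ N0) => // k _; exact: sqnorm2_ge0.
by rewrite !mxE.
Qed.

Lemma mxtrace_gram_rows n p (N : 'M[R]_(p, n)) :
  \tr (N^T *m N) = \sum_i sqnorm2 ((row i N)^T).
Proof.
rewrite mxtrace_mulC -{1}(trmxK N) mxtrace_gram.
by apply: eq_bigr => i _; rewrite -tr_row.
Qed.

Lemma psdmx_trace_ge0 n (M : 'M[R]_n) : psdmx M -> 0 <= \tr M.
Proof. by move=> /psdmx_factor[F ->]; exact: mxtrace_gram_ge0. Qed.

Lemma cauchy_schwarz n (x y : 'cV[R]_n) :
  (x^T *m y) 0 0 ^+ 2 <= sqnorm2 x * sqnorm2 y.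
Proof.
have [y0|yn0] := eqVneq (sqnorm2 y) 0.
  by rewrite y0 (sqnorm2_eq0 y0) mulmx0 mxE mulr0 expr0n.
have ygt0 : 0 < sqnorm2 y by rewrite lt_def yn0 sqnorm2_ge0.
have := sqnorm2_ge0 (x + (- ((x^T *m y) 0 0 / sqnorm2 y)) *: y).
rewrite sqnorm2D sqnorm2Z -scalemxAr [X in 2 * X]mxE.
set t := (_ *m _) 0 0; set u := sqnorm2 x; set v := sqnorm2 y.
have -> : u + 2 * (- (t / v) * t) + (- (t / v)) ^+ 2 * v = u - t ^+ 2 / v.
  by field.
by rewrite subr_ge0 ler_pdivrMr.
Qed.

Lemma sqnorm2_mul_le n p (N : 'M[R]_(p, n)) x :
  sqnorm2 (N *m x) <= \tr (N^T *m N) * sqnorm2 x.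
Proof.
rewrite mxtrace_gram_rows mulr_suml; apply: ler_sum => i _.
have -> : (N *m x) i 0 = (((row i N)^T)^T *m x) 0 0.
  by rewrite trmxK -row_mul [RHS]mxE.
exact: cauchy_schwarz.
Qed.

(** If [M = F^T F], then [|x| <= |F^-1| |F x|] with the Frobenius norm of [F^-1]; this gives the
    constant without eigenvalues or compactness. It converts bounds against the identity into bounds
    against the sum of the [S k]. *)
Lemma pdmx_coercive n (M : 'M[R]_n) : pdmx M ->
  exists2 k, 0 <= k & forall x, sqnorm2 x <= k * qform M x.
Proof.
move=> [sM pM].
have /psdmx_factor[F FE] : psdmx M.
  split=> // x; have [->|x0] := eqVneq x 0; last exact/ltW/pM.
  by rewrite mulmx0 mxE.
have uF : F \in unitmx.
  rewrite -unitmx_tr unitmxE unitfE -/(\det _) -unitfE -unitmxE.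
  rewrite -row_free_unit -kermx_eq0; apply/rowV0P => v /sub_kermxP vF0.
  apply/eqP; apply: contraT => v0.
  have := pM v^T; rewrite -trmx0 (inj_eq trmx_inj) => /(_ v0).
  rewrite -/(qform _ _) FE -sqnorm2_mul.
  have -> : F *m v^T = 0 by rewrite -(trmxK F) -trmx_mul vF0 trmx0.
  by rewrite sqnorm2E mulmx0 mxE ltxx.
exists (\tr ((invmx F)^T *m invmx F)); first exact: mxtrace_gram_ge0.
move=> x; rewrite FE -sqnorm2_mul -{1}(mulKmx uF x); exact: sqnorm2_mul_le.
Qed.

(** Identifies the trace pairing with the dot product of flattened matrices, the form in which the
    separation result delivers its functional. *)
Lemma mxtrace_mulE p q (Y Z : 'M[R]_(p, q)) :
  \tr (Y^T *m Z) = \sum_i mxvec Y 0 i * mxvec Z 0 i.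
Proof.
rewrite (reindex _ (curry_mxvec_bij p q))/=.
rewrite (eq_bigr (fun ij : 'I_p * 'I_q => Y ij.1 ij.2 * Z ij.1 ij.2)); last first.
  by move=> [i j] _ /=; rewrite !mxvecE.
rewrite -(pair_bigA _ (fun i j => Y i j * Z i j))/= exchange_big/=.
by apply: eq_bigr => j _; rewrite mxE; apply: eq_bigr => i _; rewrite mxE.
Qed.

Lemma qform_le_trace n (Z : 'M[R]_n) x :
  `|qform Z x| <= Num.sqrt (\tr (Z^T *m Z)) * sqnorm2 x.
Proof.
have x0 := sqnorm2_ge0 x; have z0 := mxtrace_gram_ge0 Z.
rewrite -(@ler_sqr _ `|_|) ?nnegrE ?normr_ge0 ?mulr_ge0 ?sqrtr_ge0//.
rewrite real_normK ?num_real// exprMn sqr_sqrtr//.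
rewrite /qform -mulmxA (le_trans (cauchy_schwarz _ _))//.
by rewrite mulrC expr2 mulrA ler_wpM2r// sqnorm2_mul_le.
Qed.

(** The defect of convexity is itself a Gram matrix. This makes the quadratic matrix constraint
    convex in [H] and, under the trace, the objective as well. *)
Lemma gram_convex p q (t : R) (X Y : 'M[R]_(p, q)) :
  (t *: X + (1 - t) *: Y)^T *m (t *: X + (1 - t) *: Y) =
  t *: (X^T *m X) + (1 - t) *: (Y^T *m Y)
  - (t * (1 - t)) *: ((X - Y)^T *m (X - Y)).
Proof.
apply/matrixP => i j; rewrite !mxE !mulr_sumr -big_split -sumrB/=.
by apply: eq_bigr => k _; rewrite !mxE; ring.
Qed.

End psd.

(** * Conic duality *)

Section separation.
Context (R : realType) (N : nat).
Implicit Types (C : set 'rV[R]_N) (p x y z : 'rV[R]_N).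

Lemma continuous_sumsq (a : R) (b : 'I_N -> R) :
  continuous (fun x : 'rV[R]_N => \sum_i (a * x 0 i + b i) ^+ 2).
Proof.
apply: continuous_big => [|i _ x]; first exact: add_continuous.
have cc : {for x, continuous (fun x : 'rV[R]_N => a * x 0 i + b i)}.
  apply: (@continuousD _ R^o _ (fun x : 'rV[R]_N => a * x 0 i) (cst (b i))).
    apply: (@continuousM _ _ (cst a) (fun x : 'rV[R]_N => x 0 i)).
      exact: cst_continuous.
    exact: coord_continuous.
  exact: cst_continuous.
exact: (continuous_comp cc (@exprn_continuous _ 2 _)).
Qed.

Lemma bounded_sumsq (c : R) p :
  bounded_set [set x : 'rV[R]_N | \sum_i (x 0 i - p 0 i) ^+ 2 <= c].
Proof.
exists (`|p| + (c + 1)); split; first exact: num_real.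
move=> M ltM x /= xc; apply: le_trans (ltW ltM).
rewrite -[x](subrK p) addrC (le_trans (ler_normD _ _))// lerD2l.
have c0 : 0 <= c by apply: le_trans xc; apply: sumr_ge0 => i _; exact: sqr_ge0.
rewrite [leLHS]mx_normrE; apply: bigmax_le; first by rewrite addr_ge0.
move=> [i j] _ /=; rewrite (ord1 i) !mxE.
have : (x 0 j - p 0 j) ^+ 2 <= c.
  apply: le_trans xc; rewrite (bigD1 j)//= lerDl.
  by apply: sumr_ge0 => k _; exact: sqr_ge0.
by rewrite ler_norml; set u := _ - _; move=> uc; nra.
Qed.

(* The functional is [c - p], where [c] is the point of the closure of [C]
   nearest to [p]. *)
Lemma convex_separation C p (d : R) : 0 < d -> C !=set0 ->
  (forall x y t, C x -> C y -> 0 <= t <= 1 -> C (t *: x + (1 - t) *: y)) ->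
  (forall x, C x -> d <= \sum_i (x 0 i - p 0 i) ^+ 2) ->
  exists y, forall z, C z -> d <= \sum_i y 0 i * (z 0 i - p 0 i).
Proof.
move=> d0 [c0 Cc0] cvxC dC.
pose f x := \sum_i (x 0 i - p 0 i) ^+ 2.
have cf : continuous f.
  rewrite (_ : f = fun x => \sum_i (1 * x 0 i + (- p 0 i)) ^+ 2).
    exact: continuous_sumsq.
  by apply/funext => x; apply: eq_bigr => i _; rewrite mul1r.
have clos_le (g : 'rV[R]_N -> R) m : continuous g ->
    (forall x, C x -> m <= g x) -> forall x, closure C x -> m <= g x.
  move=> cg Cm x.
  have /closure_id cl : closed (g @^-1` [set r | m <= r]).
    by apply: (continuous_closedP g).1 => //; exact: closed_ge.
  suff : closure C `<=` g @^-1` [set r | m <= r] by apply.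
  by rewrite cl; apply: closureS => z /Cm.
(* The sublevel set of [f] at [c0] makes the minimisation compact without changing the minimum. *)
pose A := closure C `&` [set x | f x <= f c0].
have [c] : exists2 c, c \in A & forall t, t \in A -> f c <= f t.
  apply: EVT_min_rV; last exact: continuous_subspaceT.
    by exists c0; split; [exact: topology_structure.subset_closure|rewrite /= lexx].
  apply: bounded_closed_compact.
    apply: sub_boundedr (bounded_sumsq (f c0) p).
    by move=> P; apply: subset_trans => x [].
  apply: closedI; first exact: closed_closure.
  exact: ((continuous_closedP f).1 cf _ (@closed_le R (f c0))).
rewrite inE => -[clc fc] minc.
have fcC x : C x -> f c <= f x.
  move=> Cx; have [fx|fx] := leP (f x) (f c0).
    by apply: minc; rewrite inE; split => //; exact: topology_structure.subset_closure.
  exact: le_trans (ltW fx).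
have dfc : d <= f c by exact: (clos_le f d).
exists (c - p) => z Cz.
pose a := \sum_i (c 0 i - p 0 i) * (z 0 i - c 0 i).
pose q := \sum_i (z 0 i - c 0 i) ^+ 2.
have q0 : 0 <= q by apply: sumr_ge0 => i _; exact: sqr_ge0.
(* This expands [f c <= f (c + t (z - c))]. Convexity is available on [C] while [c] lies in the
   closure, so the inequality is shown with points of [C] in the place of [c] and then passes to the
   closure. *)
have aq t : 0 <= t <= 1 -> 0 <= 2 * t * a + t ^+ 2 * q.
  move=> t01.
  have -> : 2 * t * a + t ^+ 2 * q =
      \sum_i ((1 - t) * c 0 i + (t * z 0 i - p 0 i)) ^+ 2 - f c.
    rewrite /a /q /f !mulr_sumr -big_split -sumrB/=.
    by apply: eq_bigr => i _; ring.
  rewrite subr_ge0.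
  apply: (clos_le (fun x => \sum_i ((1 - t) * x 0 i + (t * z 0 i - p 0 i)) ^+ 2)).
  - exact: continuous_sumsq.
  - move=> x Cx; have := fcC _ (cvxC _ _ _ Cz Cx t01).
    congr (_ <= _); apply: eq_bigr => i _; rewrite !mxE; congr (_ ^+ 2).
    by ring.
  - by [].
have a0 : 0 <= a.
  rewrite leNgt; apply/negP => alt0.
  have q1 : 0 < q + 1 - a by lra.
  (* First-order optimality: for [a < 0] this step length lies in [[0, 1]] and is short enough for
     the negative linear term to dominate. *)
  have := aq (- a / (q + 1 - a)).
  have -> : 2 * (- a / (q + 1 - a)) * a + (- a / (q + 1 - a)) ^+ 2 * q =
     (a / (q + 1 - a)) ^+ 2 * (- q - 2 * (1 - a)) by field; rewrite gt_eqF.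
  have -> : 0 <= - a / (q + 1 - a) <= 1.
    by rewrite divr_ge0/= ?ler_pdivrMr; lra.
  move=> /(_ isT); rewrite leNgt => /negP; apply.
  rewrite pmulr_rlt0; first by lra.
  by rewrite exprn_even_gt0//= mulf_neq0// ?invr_neq0 ?(gt_eqF q1) ?(lt_eqF alt0).
apply: le_trans dfc _; rewrite -[leLHS]addr0.
rewrite [leRHS](_ : _ = f c + a) ?lerD2l//.
by rewrite /f /a -big_split/=; apply: eq_bigr => i _; rewrite !mxE; ring.
Qed.

End separation.

(** * Support function of the parameter set of an ellitope *)

Section support_function.
Context (R : realType) (n K : nat) (S : 'I_K -> 'M[R]_n) (T : set 'cV[R]_K).
Hypothesis ST : ellitope_data S T.
Implicit Types (l t tau : 'cV[R]_K).

Lemma ellitope_bounded : exists2 b : R, 0 <= b &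
  forall t, T t -> forall k, 0 <= t k 0 <= b.
Proof.
have [b b0 Tb] := pinfty_ex_gt0 (compact_bounded (ellitope_compact ST)).
exists b; first exact: ltW.
move=> t Tt k; rewrite (ellitope_orthant ST)//=.
apply: le_trans (ler_norm _) _; apply: le_trans (Tb t Tt).
rewrite [leRHS]mx_normrE.
exact: (le_bigmax_cond _ (fun ij : 'I_K * 'I_1 => `|t ij.1 ij.2|) (j := (k, 0))).
Qed.

Lemma support_fun_ge l t : T t -> \sum_k l k 0 * t k 0 <= support_fun T l.
Proof.
move=> Tt; rewrite -dotE; apply: ub_le_sup; last by exists t.
have [b b0 Tb] := ellitope_bounded.
exists (\sum_k `|l k 0| * b) => _ [s Ts <-]; rewrite dotE.
apply: ler_sum => k _; have /andP[s0 sb] := Tb s Ts k.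
by rewrite (le_trans (ler_norm _))// normrM ler_wpM2l// ger0_norm.
Qed.

Lemma support_fun_le l c :
  (forall t, T t -> \sum_k l k 0 * t k 0 <= c) -> support_fun T l <= c.
Proof.
move=> Tc; apply: ge_sup.
  by have [t Tt] := ellitope_nonempty ST; exists ((l^T *m t) 0 0); exists t.
by move=> _ [t Tt <-]; rewrite dotE; exact: Tc.
Qed.

Lemma support_funD l l' :
  support_fun T (l + l') <= support_fun T l + support_fun T l'.
Proof.
apply: support_fun_le => t Tt.
rewrite (_ : \sum_k _ = \sum_k l k 0 * t k 0 + \sum_k l' k 0 * t k 0).
  by apply: lerD; exact: support_fun_ge.
by rewrite -big_split/=; apply: eq_bigr => k _; rewrite mxE mulrDl.
Qed.

Lemma support_funZ a l : 0 <= a -> support_fun T (a *: l) <= a * support_fun T l.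
Proof.
move=> a0; apply: support_fun_le => t Tt.
rewrite (_ : \sum_k _ = a * \sum_k l k 0 * t k 0).
  by rewrite ler_wpM2l// support_fun_ge.
by rewrite mulr_sumr; apply: eq_bigr => k _; rewrite mxE mulrA.
Qed.

Lemma support_fun_ge0 l : (forall k, 0 <= l k 0) -> 0 <= support_fun T l.
Proof.
move=> l0; have [t Tt] := ellitope_nonempty ST.
apply: le_trans (support_fun_ge l Tt); apply: sumr_ge0 => k _.
by rewrite mulr_ge0 ?l0 ?(ellitope_orthant ST).
Qed.

Lemma ellitope_convexW t t' (a : R) : T t -> T t' -> 0 <= a <= 1 ->
  T (a *: t + (1 - a) *: t').
Proof.
move=> Tt Tt' /andP[a0 a1].
have [->|an0] := eqVneq a 0; first by rewrite scale0r add0r subr0 scale1r.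
have [->|an1] := eqVneq a 1; first by rewrite scale1r subrr scale0r addr0.
have /convex_setW cT := ellitope_convex ST.
have {}a0 : 0 < a by rewrite lt_def an0.
have {}a1 : a < 1 by rewrite lt_neqAle an1.
have := cT t t'; rewrite !inE => /(_ Tt Tt' (Itv01 (ltW a0) (ltW a1)) a0 a1).
by rewrite inE.
Qed.

(* The separating functional [y] may be replaced by its negative part, because
   [T] is monotone. *)
Lemma support_fun_mem tau c : (forall k, 0 <= tau k 0) ->
  (forall l, (forall k, 0 <= l k 0) ->
     \sum_k l k 0 * tau k 0 <= support_fun T l + c) -> T tau.
Proof.
move=> tau0 taul; apply: contrapT => nT.
have clT : closed T.
  exact: compact_closed (@norm_hausdorff _ _) (ellitope_compact ST).
have [e e0 eT] : exists2 e : R, 0 < e & ball tau e `<=` ~` T.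
  have oT : open (~` T) by exact: closed_openC.
  have : nbhs tau (~` T) by apply: open_nbhs_nbhs.
  by rewrite -nbhs_ballE.
have [y yP] : exists y : 'rV[R]_K, forall z, [set t^T | t in T] z ->
    e ^+ 2 <= \sum_i y 0 i * (z 0 i - tau^T 0 i).
  apply: convex_separation; first by rewrite exprn_gt0.
  - by have [t Tt] := ellitope_nonempty ST; exists t^T; exists t.
  - move=> _ _ a [t Tt <-] [t' Tt' <-] a01.
    exists (a *: t + (1 - a) *: t'); first exact: ellitope_convexW.
    by rewrite linearD/= !linearZ.
  move=> _ [t Tt <-]; rewrite leNgt; apply/negP => lt_e.
  apply: (eT t) => //; split => // i j; rewrite (ord1 j) -ball_normE/=.
  have : (t i 0 - tau i 0) ^+ 2 < e ^+ 2.
    apply: le_lt_trans lt_e; rewrite (bigD1 i)//= !mxE lerDl.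
    by apply: sumr_ge0 => k _; exact: sqr_ge0.
  by rewrite distrC -(@ltr_sqr _ _ e) ?nnegrE ?normr_ge0 ?(ltW e0)// real_normK ?num_real.
pose l : 'cV[R]_K := \col_k Num.max 0 (- y 0 k).
have l0 k : 0 <= l k 0 by rewrite mxE le_max lexx.
have lt_tau : support_fun T l <= \sum_k l k 0 * tau k 0 - e ^+ 2.
  apply: support_fun_le => t Tt.
  pose t' : 'cV[R]_K := \col_k (if 0 <= y 0 k then 0 else t k 0).
  have Tt' : T t'.
    apply: (ellitope_monotone ST _ Tt) => k; rewrite mxE.
    have := ellitope_orthant ST Tt k => tk0.
    by case: ifP => _; rewrite lexx tk0.
  have := yP t'^T; have : [set t^T | t in T] t'^T by exists t'.
  move=> H /(_ H) {H}.
  rewrite lerBrDl -lerBrDr -sumrB => /le_trans; apply.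
  apply: ler_sum => k _; rewrite !mxE.
  have := tau0 k; have := ellitope_orthant ST Tt k.
  case: (leP 0 (y 0 k)) => y0 t0 tk0.
    by rewrite max_l ?oppr_le0// !mul0r subrr sub0r mulrN; nra.
  by rewrite max_r ?oppr_ge0 ?(ltW y0)//; nra.
have e20 : 0 < e ^+ 2 by rewrite exprn_gt0.
(* Homogeneity removes the additive slack: scaling [l] by [s] turns the gap [e ^+ 2] into [|c| + 1],
   which exceeds [c]. *)
pose s := (`|c| + 1) / e ^+ 2.
have s0 : 0 <= s by rewrite divr_ge0 ?(ltW e20) ?addr_ge0.
have sl0 k : 0 <= (s *: l) k 0 by rewrite mxE mulr_ge0.
have := taul (s *: l) sl0.
have -> : \sum_k (s *: l) k 0 * tau k 0 = s * \sum_k l k 0 * tau k 0.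
  by rewrite mulr_sumr; apply: eq_bigr => k _; rewrite mxE mulrA.
have := support_funZ l s0; have := ler_wpM2l s0 lt_tau.
rewrite mulrBr /s divfK ?gt_eqF//; have := ler_norm c; lra.
Qed.

End support_function.

(** * The design problem and its dual covariance *)

Section duality.
Context (R : realType) (m n nu K : nat).
Variables (A : 'M[R]_(m, n)) (B : 'M[R]_(nu, n)) (sigma : R).
Variables (S : 'I_K -> 'M[R]_n) (T : set 'cV[R]_K).
Hypothesis ST : ellitope_data S T.
Implicit Types (H : 'M[R]_(m, nu)) (l : 'cV[R]_K) (P Q Z : 'M[R]_n).

Let D H := B - H^T *m A.

(* Bayes risk of the linear estimate [H^T omega] under any centred prior with
   covariance [Q]. *)
Definition lin_risk2 H Q : R :=
  \tr (D H *m Q *m (D H)^T) + sigma ^+ 2 * \tr (H^T *m H).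

Let Sl l := \sum_k l k 0 *: S k.

Let psdSl l : (forall k, 0 <= l k 0) -> psdmx (Sl l).
Proof.
move=> l0; apply: psdmx_sum => k; apply: psdmxZ => //.
exact: (ellitope_psd ST).
Qed.

(** The epigraph of the optimal value as a function of a perturbation [Z] of the matrix constraint:
    [D H^T D H] is below [Sl l + Z] with slack [P], and the objective is at most [v]. The pair
    [(Z, v)] is flattened to a row vector so that separation applies. *)
Let Wset (z : 'rV[R]_(n * n + 1)) := exists H l P (v : R),
  [/\ forall k, 0 <= l k 0, psdmx P,
      sigma ^+ 2 * \tr (H^T *m H) + support_fun T l <= v &
      z = row_mx (mxvec ((D H)^T *m D H - Sl l + P)) v%:M].

Let mxvec_row_sum (Z : 'M[R]_n) (v : R) (F : 'I_(n * n + 1) -> R -> R) :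
  \sum_i F i (row_mx (mxvec Z) v%:M 0 i) =
  \sum_i F (lshift 1 i) (mxvec Z 0 i) + F (rshift (n * n) ord0) v.
Proof.
rewrite big_split_ord/=; congr (_ + _).
  by apply: eq_bigr => i _; rewrite row_mxEl.
by rewrite big_ord1 row_mxEr mxE mulr1n.
Qed.

Let Wset_convex z z' (t : R) : Wset z -> Wset z' -> 0 <= t <= 1 ->
  Wset (t *: z + (1 - t) *: z').
Proof.
move=> [H [l [P [v [l0 P0 vP ->]]]]] [H' [l' [P' [v' [l0' P0' vP' ->]]]]].
move=> /andP[t0 t1]; have t1' : 0 <= 1 - t by rewrite subr_ge0.
exists (t *: H + (1 - t) *: H'), (t *: l + (1 - t) *: l').
(* The last summand of the new slack is the Gram defect of [gram_convex]. *)
exists (t *: P + (1 - t) *: P' +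
  (t * (1 - t)) *: ((D H - D H')^T *m (D H - D H'))), (t * v + (1 - t) * v').
split.
- by move=> k; rewrite !mxE addr_ge0// mulr_ge0.
- apply: psdmxD; last by apply: psdmxZ (psdmx_gram _); exact: mulr_ge0.
  by apply: psdmxD; exact: psdmxZ.
- have sl := support_funD ST (t *: l) ((1 - t) *: l').
  have sl1 := support_funZ ST l t0; have sl2 := support_funZ ST l' t1'.
  have trH : \tr ((t *: H + (1 - t) *: H')^T *m (t *: H + (1 - t) *: H')) <=
      t * \tr (H^T *m H) + (1 - t) * \tr (H'^T *m H').
    rewrite gram_convex mxtraceD linearN/= mxtraceD !mxtraceZ lerBlDr lerDl.
    by rewrite !mulr_ge0// mxtrace_gram_ge0.
  have s0 : 0 <= sigma ^+ 2 by exact: sqr_ge0.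
  have := ler_wpM2l s0 trH; have := ler_wpM2l t0 vP; have := ler_wpM2l t1' vP'.
  rewrite !mulrDr !(mulrCA (sigma ^+ 2)); lra.
have mxvec_lin (a b : 'M[R]_n) :
    t *: mxvec a + (1 - t) *: mxvec b = mxvec (t *: a + (1 - t) *: b).
  by rewrite linearD !linearZ.
rewrite !scale_row_mx add_row_mx mxvec_lin; congr (row_mx (mxvec _) _).
  have -> : D (t *: H + (1 - t) *: H') = t *: D H + (1 - t) *: D H'.
    rewrite /D linearD/= !linearZ/= mulmxDl -!scalemxAl !scalerBr addrACA.
    by rewrite -scalerDl [t + _]addrC subrK scale1r -opprD.
  have -> : Sl (t *: l + (1 - t) *: l') = t *: Sl l + (1 - t) *: Sl l'.
    rewrite /Sl !scaler_sumr -big_split/=; apply: eq_bigr => k _.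
    by apply/matrixP => i j; rewrite !mxE; ring.
  rewrite gram_convex; move: (_^T *m _) (_^T *m _) (_^T *m _) (Sl _) (Sl _).
  by move=> G G' G'' S1 S2; apply/matrixP => i j; rewrite !mxE; ring.
by apply/matrixP => i j; rewrite !mxE (ord1 i) (ord1 j)/= !mulr1n.
Qed.

(* A point strictly below the epigraph of the design problem, at zero
   perturbation of the matrix constraint, is separated from [Wset]; the slope in
   the matrix direction is the covariance [Q]. *)
Lemma design_dual (Opt eps : R) : 0 < eps ->
  (forall p, design_feasible A B S p -> Opt <= design_objective sigma T p) ->
  exists2 Q, matrix_ellitope S T Q & forall H, Opt - eps <= lin_risk2 H Q.
Proof.
move=> eps0 Optle.
have [kap kap0 kapP] := pdmx_coercive (ellitope_pd ST).
pose one : 'cV[R]_K := const_mx 1.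
have Sone : Sl one = \sum_k S k.
  by apply: eq_bigr => k _; rewrite mxE scale1r.
have one0 k : 0 <= one k 0 by rewrite mxE.
have phi0 := support_fun_ge0 ST one0.
(* A matrix perturbation of size [del] is repaired by adding [del * kap] to every multiplier, which
   costs [del * kap * support_fun T one]; with a value gap of [del] the total is exactly [eps]. *)
pose del := eps / (1 + kap * support_fun T one).
have den0 : 0 < 1 + kap * support_fun T one by rewrite ltr_pwDl// mulr_ge0.
have del0 : 0 < del by rewrite divr_gt0.
pose p : 'rV[R]_(n * n + 1) := row_mx 0 (Opt - eps)%:M.
(* A point of [Wset] closer than [del] to [p] has [Z] below [del] times the identity, hence below
   [del * kap] times the sum of the [S k]. Enlarging [l] accordingly gives a feasible pair with
   objective below [Opt]. *)
have Wge z : Wset z -> del ^+ 2 <= \sum_i (z 0 i - p 0 i) ^+ 2.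
  move=> [H [l [P [v [l0 P0 vP ->]]]]]; rewrite leNgt; apply/negP.
  rewrite (mxvec_row_sum _ _ (fun i r => (r - p 0 i) ^+ 2)) /p.
  rewrite row_mxEr mxE mulr1n; set Z := _ + P.
  rewrite (eq_bigr (fun i => mxvec Z 0 i * mxvec Z 0 i)); last first.
    by move=> i _; rewrite row_mxEl mxE subr0 expr2.
  rewrite -mxtrace_mulE => Zlt.
  have Z0 := mxtrace_gram_ge0 Z.
  have Zd : Num.sqrt (\tr (Z^T *m Z)) <= del.
    rewrite -(@ler_sqr _ (Num.sqrt _)) ?nnegrE ?sqrtr_ge0 ?(ltW del0)// sqr_sqrtr//.
    have := sqr_ge0 (v - (Opt - eps)); lra.
  have vd : v - (Opt - eps) < del.
    by have := ltW del0; set u := v - _ in Zlt * => d0; nra.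
  have lk0 k : 0 <= (l + (del * kap) *: one) k 0.
    by rewrite !mxE mulr1 addr_ge0// mulr_ge0// ltW.
  have := Optle (H, l + (del * kap) *: one).
  rewrite /design_feasible /design_objective/= => /(_ (conj _ lk0)).
  have fS : loewner_le ((D H)^T *m D H) (Sl (l + (del * kap) *: one)).
    split.
      apply/symmetricmxP; rewrite linearB/= trmx_mul trmxK; congr (_ - _).
      exact: psdmx_sym (psdSl lk0).
    move=> x; rewrite -/(qform _ _).
    have -> : Sl (l + (del * kap) *: one) = Sl l + (del * kap) *: \sum_k S k.
      rewrite -Sone /Sl scaler_sumr -big_split/=; apply: eq_bigr => k _.
      by rewrite !mxE scalerDl scalerA.
    have := P0.2 x; rewrite -/(qform _ _) qformD qformN qformD qformZ => Px.
    have : qform Z x <= del * sqnorm2 x.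
      apply: le_trans (ler_norm _) _; apply: le_trans (qform_le_trace Z x) _.
      by rewrite ler_wpM2r// sqnorm2_ge0.
    rewrite /Z !qformD qformN.
    by have := ler_wpM2l (ltW del0) (kapP x); rewrite mulrA; lra.
  move=> /(_ fS).
  have := support_funD ST l ((del * kap) *: one).
  have := support_funZ ST one (mulr_ge0 (ltW del0) kap0).
  have : del * (1 + kap * support_fun T one) = eps by rewrite divfK// gt_eqF.
  rewrite mulrDr mulr1 mulrA; lra.
have [y yP] : exists y : 'rV[R]_(n * n + 1),
    forall z, Wset z -> del ^+ 2 <= \sum_i y 0 i * (z 0 i - p 0 i).
  apply: convex_separation Wge; first by rewrite exprn_gt0.
    exists (row_mx (mxvec ((D 0)^T *m D 0 - Sl 0 + 0)) (sigma ^+ 2 *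
       \tr ((0 : 'M[R]_(m, nu))^T *m 0) + support_fun T 0)%:M).
    exists 0, 0, 0, (sigma ^+ 2 *
       \tr ((0 : 'M[R]_(m, nu))^T *m 0) + support_fun T 0); split => //.
      by move=> k; rewrite mxE.
    exact: psdmx0.
  by move=> z z' t; exact: Wset_convex.
pose Y : 'M[R]_n := vec_mx (lsubmx y).
pose mu := y 0 (rshift (n * n) ord0).
have {}yP H l P v : (forall k, 0 <= l k 0) -> psdmx P ->
    sigma ^+ 2 * \tr (H^T *m H) + support_fun T l <= v ->
    del ^+ 2 <= \tr (Y^T *m ((D H)^T *m D H - Sl l + P)) + mu * (v - (Opt - eps)).
  move=> l0 P0 vP; set Z := _ + P.
  have /yP : Wset (row_mx (mxvec Z) v%:M) by exists H, l, P, v.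
  rewrite (mxvec_row_sum _ _ (fun i r => y 0 i * (r - p 0 i))) /p.
  rewrite row_mxEr mxE mulr1n mxtrace_mulE /Y vec_mxK.
  congr (_ <= _ + _); apply: eq_bigr => i _.
  by rewrite row_mxEl !mxE subr0.
have del20 : 0 < del ^+ 2 by rewrite exprn_gt0.
have z0 (k : 'I_K) : 0 <= (0 : 'cV[R]_K) k 0 by rewrite mxE.
(* [Wset] is closed under increasing [v], so a negative slope would make the separated values
   unbounded below. *)
have mu0 : 0 <= mu.
  rewrite leNgt; apply/negP => mu0.
  set v0 := sigma ^+ 2 * \tr ((0 : 'M[R]_(m, nu))^T *m 0) + support_fun T 0.
  have := yP 0 0 0 (v0 + (`|\tr (Y^T *m ((D 0)^T *m D 0 - Sl 0 + 0)) +
     mu * (v0 - (Opt - eps))|) / - mu) z0 (psdmx0 _ _).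
  have muN : 0 <= - mu by rewrite oppr_ge0 ltW.
  rewrite lerDl divr_ge0// => /(_ isT).
  set a := \tr _; rewrite addrAC mulrDr addrA.
  set b := `|_|; have -> : mu * (b / - mu) = - b by field; rewrite lt_eqF.
  have : a + mu * (v0 - (Opt - eps)) <= b by exact: ler_norm.
  lra.
(* The same argument along the ray of multiples of the slack [P]. *)
have Ypsd P : psdmx P -> 0 <= \tr (Y^T *m P).
  move=> P0; rewrite leNgt; apply/negP => YP.
  set v0 := sigma ^+ 2 * \tr ((0 : 'M[R]_(m, nu))^T *m 0) + support_fun T 0.
  pose b := \tr (Y^T *m ((D 0)^T *m D 0 - Sl 0)) + mu * (v0 - (Opt - eps)).
  have := yP 0 0 ((`|b| / - \tr (Y^T *m P)) *: P) v0 z0.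
  have YN : 0 <= - \tr (Y^T *m P) by rewrite oppr_ge0 ltW.
  move=> /(_ (psdmxZ (divr_ge0 (normr_ge0 b) YN) P0) (lexx _)).
  rewrite mulmxDr mxtraceD -scalemxAr mxtraceZ.
  have -> : `|b| / - \tr (Y^T *m P) * \tr (Y^T *m P) = - `|b|.
    by field; rewrite lt_eqF.
  by have := ler_norm b; rewrite /b; lra.
(* The hyperplane is not vertical: at [H = 0] a large multiple of [one] satisfies the constraint,
   and the slack [pc] brings the matrix component to 0. With [mu = 0] the separation would read
   [del ^+ 2 <= 0] there. *)
have mugt0 : 0 < mu.
  rewrite lt_def mu0 andbT; apply/eqP => mueq.
  pose c := \tr (B^T *m B) * kap.
  have c0 : 0 <= c by rewrite mulr_ge0// mxtrace_gram_ge0.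
  have cone k : 0 <= (c *: one) k 0 by rewrite !mxE mulr1.
  have pc : psdmx (Sl (c *: one) - B^T *m B).
    split.
      apply/symmetricmxP; rewrite linearB/= trmx_mul trmxK; congr (_ - _).
      exact: psdmx_sym (psdSl cone).
    move=> x; rewrite -/(qform _ _) qformD qformN -sqnorm2_mul subr_ge0.
    have -> : Sl (c *: one) = c *: \sum_k S k.
      rewrite -Sone /Sl scaler_sumr; apply: eq_bigr => k _.
      by rewrite !mxE scalerA.
    rewrite qformZ (le_trans (sqnorm2_mul_le _ _))// /c -mulrA.
    by rewrite ler_wpM2l// mxtrace_gram_ge0.
  have := yP 0 _ _ _ cone pc (lexx _).
  rewrite mueq mul0r addr0 /D trmx0 mul0mx subr0 addrA subrK subrr mulmx0.
  by rewrite mxtrace0 leNgt del20.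
(* [Y] comes from a functional on all matrices and may fail to be symmetric. Its symmetric part
   gives the same pairing with symmetric matrices; dividing by [mu] normalises the slope in [v] to
   1. *)
pose Q := (2 * mu)^-1 *: (Y + Y^T).
have YQ P : P^T = P -> \tr (Y^T *m P) = mu * \tr (Q *m P).
  move=> sP; rewrite /Q -scalemxAl mulmxDl mxtraceZ mxtraceD.
  have -> : \tr (Y *m P) = \tr (Y^T *m P).
    by rewrite -mxtrace_tr trmx_mul sP mxtrace_mulC.
  by field; rewrite gt_eqF.
have psdQ : psdmx Q.
  split=> [|x].
    by apply/symmetricmxP; rewrite /Q linearZ/= linearD/= trmxK addrC.
  have xx : psdmx (x *m x^T) by rewrite -{1}(trmxK x); exact: psdmx_gram.
  have := Ypsd _ xx; rewrite YQ ?psdmx_sym// pmulr_rge0//.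
  by rewrite mulmxA mxtrace_mulC mulmxA trace_mx11.
have main H l : (forall k, 0 <= l k 0) ->
    Opt - eps <= lin_risk2 H Q - \sum_k l k 0 * \tr (Q *m S k) + support_fun T l.
  move=> l0.
  have := yP H l 0 _ l0 (psdmx0 _ _) (lexx _).
  have sSl := psdmx_sym (psdSl l0).
  rewrite addr0 YQ; last by rewrite linearB/= trmx_mul trmxK sSl.
  rewrite -mulrDr => /(lt_le_trans del20); rewrite pmulr_rgt0//.
  rewrite mulmxDr mulmxN linearD linearN/=.
  have -> : \tr (Q *m Sl l) = \sum_k l k 0 * \tr (Q *m S k).
    rewrite /Sl mulmx_sumr linear_sum/=; apply: eq_bigr => k _.
    by rewrite -scalemxAr mxtraceZ.
  have -> : \tr (Q *m ((D H)^T *m D H)) = \tr (D H *m Q *m (D H)^T).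
    by rewrite mulmxA mxtrace_mulC mulmxA.
  rewrite /lin_risk2; lra.
exists Q; last first.
  move=> H; have := main H 0 z0.
  rewrite big1 => [|k _]; last by rewrite mxE mul0r.
  have : support_fun T 0 <= 0.
    apply: (support_fun_le ST) => t Tt.
    by rewrite big1// => k _; rewrite mxE mul0r.
  by rewrite subr0; lra.
split => //; exists (\col_k \tr (Q *m S k)); last by move=> k; rewrite mxE.
(* At [H = 0], [main] bounds the pairing of [l] with the traces [\tr (Q *m S k)] by the support
   function up to a constant independent of [l]; this is the membership criterion. *)
apply: (support_fun_mem ST (c := lin_risk2 0 Q - (Opt - eps))).
  move=> k; rewrite mxE; have [F ->] := psdmx_factor psdQ.
  rewrite -mulmxA mxtrace_mulC.
  have := psdmx_trace_ge0 (psdmx_congr F^T (ellitope_psd ST k)).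
  by rewrite trmxK.
move=> l l0; have := main 0 l l0.
by under [in X in _ -> X]eq_bigr => k _ do rewrite mxE; lra.
Qed.

End duality.

(** * Gaussian vectors *)

Lemma invsqrt_le (R : rcfType) (d p : R) : (0 < d) -> (0 <= p) -> (1 <= p ^+ 2 * d) ->
  ((Num.sqrt d)^-1 <= p).
Proof.
move=> d0 p0 pd; rewrite -[leLHS]mul1r ler_pdivrMr ?sqrtr_gt0//.
rewrite -[leLHS]sqrtr1 -{1}(ger0_norm p0) -sqrtr_sqr -sqrtrM ?sqr_ge0//.
exact: ler_wsqrtr.
Qed.

(** * The standard normal law on the line *)

Section normal1.
Context (R : realType).
Local Open Scope ereal_scope.
Local Notation mu := (@lebesgue_measure R).
Local Notation N1 := (normal_prob (0 : R) 1).

(** The Radon-Nikodym derivative of the law equals [normal_pdf] almost everywhere, because both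
    integrate to the law over every measurable set. *)
Lemma ge0_integral_normal_prob (f : R -> \bar R) :
  measurable_fun setT f -> (forall x, 0 <= f x) ->
  \int[N1]_x f x = \int[mu]_x (f x * (normal_pdf 0 1 x)%:E).
Proof.
move=> mf f0.
have dom : N1 `<< mu by exact: normal_prob_dominates.
rewrite -(Radon_Nikodym_SigmaFinite.change_of_variables dom)//.
have mpdf : measurable_fun setT (fun x => (normal_pdf (0:R) 1 x)%:E).
  by apply/measurable_EFinP; exact: measurable_normal_pdf.
have iRN := Radon_Nikodym_SigmaFinite.f_integrable dom.
apply: ae_eq_integral => //.
- by apply: emeasurable_funM => //; exact: measurable_int iRN.
- exact: emeasurable_funM.
apply: ae_eqe_mul2l; apply: integral_ae_eq => //.
move=> E _ mE; rewrite -(Radon_Nikodym_SigmaFinite.f_integral dom)//.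
Qed.

Lemma ge0_integral_lebesgue_shift (f : R -> \bar R) (a : R) :
  measurable_fun setT f -> (forall x, 0 <= f x) ->
  \int[mu]_x f (x + a)%R = \int[mu]_x f x.
Proof.
move=> mf f0.
have ms : measurable_fun setT (fun x : R => (x + a)%R : measurableTypeR R).
  exact: measurable_funD.
rewrite -[LHS](@ge0_integral_pushforward _ _ (measurableTypeR R) (measurableTypeR R) _ _ ms mu setT)//=.
apply: eq_measure_integral => //= U mU _.
apply/esym/lebesgue_measure_unique => //= _ [[b c]] _ <-.
rewrite /pushforward.
have -> : (fun x : R => (x + a)%R) @^-1` `]b, c]%classic =
    `](b - a)%R, (c - a)%R]%classic.
  by apply/seteqP; split => x /=; rewrite !in_itv/= ltrBlDr lerBrDr.
rewrite !lebesgue_measure_itv/= !lte_fin ltrD2r.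
by case: ifP => // _; rewrite -!EFinB; congr (_%:E); ring.
Qed.

Lemma ge0_integral_lebesgueN (f : R -> \bar R) :
  measurable_fun setT f -> (forall x, 0 <= f x) ->
  \int[mu]_x f (- x)%R = \int[mu]_x f x.
Proof.
move=> mf f0.
have ms : measurable_fun setT (fun x : R => (- x)%R : measurableTypeR R).
  exact: oppr_measurable.
rewrite -[LHS](@ge0_integral_pushforward _ _ (measurableTypeR R) (measurableTypeR R) _ _ ms mu setT)//=.
by apply: eq_measure_integral => //= U mU _; exact: lebesgue_measureN.
Qed.

Lemma normal_pdf01 (x : R) :
  normal_pdf 0 1 x = ((Num.sqrt (pi *+ 2))^-1 * expR (- (x ^+ 2 / 2)))%R.
Proof.
rewrite normal_pdfE ?oner_neq0//= /normal_peak /normal_fun expr1n mul1r subr0.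
by rewrite mulNr.
Qed.

Lemma normal_prob_oppr (f : R -> \bar R) :
  measurable_fun setT f -> (forall x, 0 <= f x) ->
  \int[N1]_x f (- x)%R = \int[N1]_x f x.
Proof.
move=> mf f0.
rewrite !ge0_integral_normal_prob//; last first.
  by apply: (measurableT_comp mf); exact: oppr_measurable.
pose F (x : R) := f x * (normal_pdf 0 1 x)%:E.
transitivity (\int[mu]_x F (- x)%R).
  by apply: eq_integral => x _; rewrite /F !normal_pdf01 sqrrN.
apply: ge0_integral_lebesgueN.
- apply: emeasurable_funM => //; apply/measurable_EFinP.
  exact: measurable_normal_pdf.
- by move=> x; rewrite mule_ge0// lee_fin normal_pdf_ge0.
Qed.

(** Cameron-Martin in dimension one: the weight is the ratio of the densities of [N(a, 1)] and
    [N(0, 1)]. *)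
Lemma normal_prob_shift (f : R -> \bar R) (a : R) :
  measurable_fun setT f -> (forall x, 0 <= f x) ->
  \int[N1]_x f (x + a)%R =
  \int[N1]_x (f x * (expR (a * x - a ^+ 2 / 2))%:E).
Proof.
move=> mf f0.
have mE : measurable_fun setT (fun x : R => (expR (a * x - a ^+ 2 / 2))%:E).
  apply/measurable_EFinP/measurableT_comp => //.
  by apply: measurable_funB => //; exact: measurable_funM.
have mpdf : measurable_fun setT (fun x => (normal_pdf (0:R) 1 x)%:E).
  by apply/measurable_EFinP; exact: measurable_normal_pdf.
rewrite !ge0_integral_normal_prob//; last 3 first.
- exact: emeasurable_funM.
- by move=> x; rewrite mule_ge0// lee_fin expR_ge0.
- by apply: (measurableT_comp mf); exact: measurable_funD.
pose F (x : R) := f x * (expR (a * x - a ^+ 2 / 2))%:E * (normal_pdf 0 1 x)%:E.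
transitivity (\int[mu]_x F (x + a)%R).
  apply: eq_integral => x _; rewrite /F -muleA -EFinM; congr (_ * _%:E).
  rewrite !normal_pdf01 mulrCA -expRD; congr (_ * expR _)%R.
  by field.
apply: ge0_integral_lebesgue_shift.
- by do 2?apply: emeasurable_funM.
- move=> x; rewrite !mule_ge0// lee_fin ?expR_ge0//.
  exact: normal_pdf_ge0.
Qed.

(* The integrand is a multiple of the density of [N(0, (1 - 2 t)^-1)]. *)
Lemma normal_prob_exp_sqr (t : R) : (t < 2^-1)%R ->
  \int[N1]_x (expR (t * x ^+ 2))%:E = ((Num.sqrt (1 - 2 * t))^-1)%R%:E.
Proof.
move=> t2.
pose s : R := (Num.sqrt (1 - 2 * t))^-1%R.
have d0 : (0 < 1 - 2 * t)%R by lra.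
have s0 : (0 < s)%R by rewrite invr_gt0 sqrtr_gt0.
have s2 : (s ^+ 2 = (1 - 2 * t)^-1)%R by rewrite exprVn sqr_sqrtr// ltW.
have mE : measurable_fun setT (fun x : R => (expR (t * x ^+ 2))%:E).
  by apply/measurable_EFinP/measurableT_comp => //; exact: measurable_funM.
rewrite ge0_integral_normal_prob//.
transitivity (\int[mu]_x (s%:E * (normal_pdf 0 s x)%:E)).
  apply: eq_integral => x _; rewrite -!EFinM; congr (_%:E).
  rewrite normal_pdf01 normal_pdfE ?gt_eqF//= /normal_peak /normal_fun.
  rewrite mulrCA -expRD [RHS]mulrA; congr (_ * expR _)%R.
    rewrite -mulrnAr sqrtrM ?sqr_ge0// sqrtr_sqr ger0_norm ?(ltW s0)//.
    by rewrite invfM mulrA divff ?gt_eqF// mul1r.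
  rewrite subr0 s2; field.
  by rewrite gt_eqF.
rewrite ge0_integralZl//.
- by rewrite integral_normal_pdf mule1.
- by apply/measurable_EFinP; exact: measurable_normal_pdf.
- by move=> x _; rewrite lee_fin normal_pdf_ge0.
- by rewrite lee_fin ltW.
Qed.

(* Both bounds come from [1 + u <= expR u] at [u = t * x ^+ 2], for small
   [t > 0] and for small [t < 0]. *)
Lemma normal_prob_sqr : \int[N1]_x (x ^+ 2)%:E = 1.
Proof.
have msq : measurable_fun setT (fun x : R => (x ^+ 2)%:E).
  by apply/measurable_EFinP; exact: exprn_measurable.
have mE t : measurable_fun setT (fun x : R => (expR (t * x ^+ 2))%:E).
  by apply/measurable_EFinP/measurableT_comp => //; exact: measurable_funM.
have mt t : measurable_fun setT (fun x : R => (t * x ^+ 2)%:E).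
  by apply/measurable_EFinP/measurable_funM => //; exact: exprn_measurable.
have int1 : \int[N1]_x (1%:E : \bar R) = 1.
  by rewrite integral_cst//= mul1e probability_setT.
set V := \int[N1]_x _.
have V0 : 0 <= V by apply: integral_ge0 => x _; rewrite lee_fin sqr_ge0.
have intV (t : R) : (0 <= t)%R -> \int[N1]_x (t * x ^+ 2)%:E = t%:E * V.
  move=> t0; under eq_integral do rewrite EFinM.
  by rewrite ge0_integralZl// => x _; rewrite lee_fin sqr_ge0.
have up (t : R) : (0 < t < 2^-1)%R -> 1 + t%:E * V <= ((Num.sqrt (1 - 2 * t))^-1)%R%:E.
  move=> /andP[t0 t2]; rewrite -normal_prob_exp_sqr// -intV ?(ltW t0)// -int1.
  rewrite -ge0_integralD//.
  - apply: ge0_le_integral => //.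
    + by move=> x _; rewrite -EFinD lee_fin addr_ge0// mulr_ge0 ?sqr_ge0// ltW.
    + by apply: emeasurable_funD; [exact: measurable_cst|exact: mt].
    + exact: mE.
    + by move=> x _; rewrite -EFinD lee_fin expR_ge1Dx.
  - by move=> x _; rewrite lee_fin mulr_ge0 ?sqr_ge0// ltW.
  - exact: mt.
have dn (t : R) : (0 < t)%R -> 1 <= ((Num.sqrt (1 + 2 * t))^-1)%R%:E + t%:E * V.
  move=> t0; rewrite -[X in (1 + X)%R]opprK -mulrN -normal_prob_exp_sqr; last lra.
  rewrite -intV ?(ltW t0)// -[leLHS]int1 -ge0_integralD//.
  - apply: ge0_le_integral => //.
    + by apply: emeasurable_funD; [exact: mE|exact: mt].
    + move=> x _; rewrite -EFinD lee_fin.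
      by have := expR_ge1Dx (- t * x ^+ 2); lra.
  - exact: mE.
  - by move=> x _; rewrite lee_fin mulr_ge0 ?sqr_ge0// ltW.
  - exact: mt.
(* The upper bound at [t = 1/4] already excludes an infinite second moment. *)
have Vfin : V \is a fin_num.
  have /up : (0 < (4^-1 : R) < 2^-1)%R by lra.
  case: V V0 {intV up dn} => //=.
  by rewrite mulry gtr0_sg ?mul1e ?invr_gt0// addey.
move: V0 up dn; rewrite -(fineK Vfin) lee_fin; move: (fine V) => v v0 up dn.
have v_le e : (0 < e <= 4^-1)%R -> (v <= 1 + 4 * e)%R.
  move=> /andP[e0 e4]; have d0 : (0 < 1 - 2 * e)%R by lra.
  have := up e; have -> : (0 < e < 2^-1)%R by lra.
  move=> /(_ isT); rewrite -EFinM -EFinD lee_fin => ve.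
  (* The Taylor coefficient of [e ^+ 2] is [3/2]. Rounding it up, to 4 here and to 2 in the lower
     bound below, leaves a polynomial inequality valid on [(0, 1/4]]. *)
  have : ((Num.sqrt (1 - 2 * e))^-1 <= 1 + e + 4 * e ^+ 2)%R.
    apply: invsqrt_le => //; first by nra.
    rewrite -subr_ge0 (_ : _ - 1 = e ^+ 2 * (5 - 10 * e - 32 * e ^+ 3))%R; last by ring.
    rewrite mulr_ge0 ?sqr_ge0//.
    have e3 : (e ^+ 3 <= 4^-1 ^+ 3)%R by apply: lerXn2r; rewrite ?nnegrE ?(ltW e0) ?invr_ge0.
    by lra.
  move=> He; rewrite -(ler_pM2l e0); nra.
have v_ge e : (0 < e <= 4^-1)%R -> (1 - 2 * e <= v)%R.
  move=> /andP[e0 e4]; have d0 : (0 < 1 + 2 * e)%R by lra.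
  have := dn e e0; rewrite -EFinM -EFinD lee_fin => ve.
  have : ((Num.sqrt (1 + 2 * e))^-1 <= 1 - e + 2 * e ^+ 2)%R.
    apply: invsqrt_le => //; first by nra.
    rewrite -subr_ge0 (_ : _ - 1 = e ^+ 2 * (1 + 6 * e - 4 * e ^+ 2 + 8 * e ^+ 3))%R; last by ring.
    rewrite mulr_ge0 ?sqr_ge0//.
    have e3 : (0 <= e ^+ 3)%R by rewrite exprn_ge0// ltW.
    by nra.
  move=> He; rewrite -(ler_pM2l e0); nra.
congr (_%:E); apply/eqP; rewrite eq_le; apply/andP; split.
  rewrite leNgt; apply/negP => v1.
  pose e := Num.min 4^-1%R ((v - 1) / 8)%R.
  have e4 : (e <= 4^-1)%R by rewrite ge_min lexx.
  have ev : (e <= (v - 1) / 8)%R by rewrite ge_min lexx orbT.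
  have e0 : (0 < e)%R by rewrite lt_min invr_gt0 ltr0n/= divr_gt0// subr_gt0.
  by have := v_le e; rewrite e0 e4 => /(_ isT); lra.
rewrite leNgt; apply/negP => v1.
pose e := Num.min 4^-1%R ((1 - v) / 4)%R.
have e4 : (e <= 4^-1)%R by rewrite ge_min lexx.
have ev : (e <= (1 - v) / 4)%R by rewrite ge_min lexx orbT.
have e0 : (0 < e)%R by rewrite lt_min invr_gt0 ltr0n/= divr_gt0// subr_gt0.
by have := v_ge e; rewrite e0 e4 => /(_ isT); lra.
Qed.

End normal1.

(** * Measurability of matrix operations *)

Section measurable_matrix.
Context (R : realType) d (U : measurableType d).
Implicit Types m n : nat.

Lemma measurable_fun_entry m n (f : U -> 'M[R]_(m, n)) i j :
  measurable_fun setT f -> measurable_fun setT (fun u => f u i j).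
Proof. by move=> mf; exact: (measurable_fun_mxP f).1. Qed.

Lemma measurable_fun_addmx m n (f g : U -> 'M[R]_(m, n)) :
  measurable_fun setT f -> measurable_fun setT g ->
  measurable_fun setT (fun u => f u + g u).
Proof.
move=> mf mg; apply/measurable_fun_mxP => i j.
under eq_fun do rewrite mxE.
by apply: measurable_funD; exact: measurable_fun_entry.
Qed.

Lemma measurable_fun_scalemx m n (a : U -> R) (f : U -> 'M[R]_(m, n)) :
  measurable_fun setT a -> measurable_fun setT f ->
  measurable_fun setT (fun u => a u *: f u).
Proof.
move=> ma mf; apply/measurable_fun_mxP => i j.
under eq_fun do rewrite mxE.
by apply: measurable_funM => //; exact: measurable_fun_entry.
Qed.

Lemma measurable_fun_oppmx m n (f : U -> 'M[R]_(m, n)) :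
  measurable_fun setT f -> measurable_fun setT (fun u => - f u).
Proof.
move=> mf; under eq_fun do rewrite -scaleN1r.
exact: measurable_fun_scalemx.
Qed.

Lemma measurable_fun_mulmx m n p (A : 'M[R]_(m, n)) (f : U -> 'M[R]_(n, p)) :
  measurable_fun setT f -> measurable_fun setT (fun u => A *m f u).
Proof.
move=> mf; apply/measurable_fun_mxP => i j.
under eq_fun do rewrite mxE.
apply: measurable_sum => k; apply: measurable_funM => //.
exact: measurable_fun_entry.
Qed.

Lemma measurable_fun_dot n (f g : U -> 'cV[R]_n) :
  measurable_fun setT f -> measurable_fun setT g ->
  measurable_fun setT (fun u => ((f u)^T *m g u) 0 0).
Proof.
move=> mf mg; under eq_fun do rewrite mxE.
apply: measurable_sum => k; apply: measurable_funM.
  by under eq_fun do rewrite mxE; exact: measurable_fun_entry.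
exact: measurable_fun_entry.
Qed.

Lemma measurable_fun_sqnorm2 n (f : U -> 'cV[R]_n) :
  measurable_fun setT f -> measurable_fun setT (fun u => sqnorm2 (f u)).
Proof.
move=> mf; under eq_fun do rewrite sqnorm2E; exact: measurable_fun_dot.
Qed.

Lemma measurable_fun_qform n (M : 'M[R]_n) (f : U -> 'cV[R]_n) :
  measurable_fun setT f -> measurable_fun setT (fun u => qform M (f u)).
Proof.
move=> mf; rewrite /qform; under eq_fun do rewrite -mulmxA.
by apply: measurable_fun_dot => //; exact: measurable_fun_mulmx.
Qed.

End measurable_matrix.

(** * The standard normal law on [R^m] *)

Section std_normal.
Context (R : realType).
Implicit Types m n p : nat.
Local Open Scope ereal_scope.

Lemma std_normal_integral0 (f : 'cV[R]_0 -> \bar R) :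
  measurable_fun setT f -> \int[std_normal R 0]_x f x = f 0%R.
Proof. by move=> mf; rewrite /= integral_dirac//= diracT mul1e. Qed.

Lemma std_normal_integralS m (f : 'cV[R]_m.+1 -> \bar R) :
  measurable_fun setT f -> (forall x, 0 <= f x) ->
  \int[std_normal R m.+1]_x f x =
  \int[normal_prob (0 : R) 1]_z \int[std_normal R m]_y f (cV_cons (z, y)).
Proof.
move=> mf f0; rewrite /= ge0_integral_distribution//.
rewrite fubini_tonelli1//; last by move=> x; exact: f0.
by apply: (measurableT_comp mf); exact: measurable_cV_cons.
Qed.

Lemma measurable_cV_cons2 m (z : R) :
  measurable_fun setT (fun y : 'cV[R]_m => cV_cons (z, y)).
Proof.
apply: (measurableT_comp (@measurable_cV_cons R m)).
exact: measurable_fun_pair.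
Qed.

Lemma measurable_std_normal_section m d (U : measurableType d)
    (F : U * 'cV[R]_m -> \bar R) :
  measurable_fun setT F -> (forall u, 0 <= F u) ->
  measurable_fun setT (fun u => \int[std_normal R m]_y F (u, y)).
Proof. move=> mF F0; exact: (measurable_fun_fubini_tonelli_F F). Qed.

Lemma cV_consE m (x : 'cV[R]_m.+1) :
  x = cV_cons (x ord0 0%R, \col_i x (lift ord0 i) 0%R).
Proof.
apply/matrixP => i j; rewrite (ord1 j).
have [->|] := eqVneq i ord0; first by rewrite cV_cons0.
by rewrite eq_sym => /unlift_some[k -> _]; rewrite cV_consS mxE.
Qed.

Lemma cV_consD m (z z' : R) (y y' : 'cV[R]_m) :
  (cV_cons (z, y) + cV_cons (z', y') = cV_cons (z + z', y + y'))%R.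
Proof.
apply/matrixP => i j; rewrite (ord1 j) mxE.
have [->|] := eqVneq i ord0; first by rewrite !cV_cons0.
by rewrite eq_sym => /unlift_some[k -> _]; rewrite !cV_consS mxE.
Qed.

Lemma cV_consN m (z : R) (y : 'cV[R]_m) :
  (- cV_cons (z, y) = cV_cons (- z, - y))%R.
Proof.
apply/matrixP => i j; rewrite (ord1 j) mxE.
have [->|] := eqVneq i ord0; first by rewrite !cV_cons0.
by rewrite eq_sym => /unlift_some[k -> _]; rewrite !cV_consS mxE.
Qed.

Lemma dot_cV_cons m (z z' : R) (y y' : 'cV[R]_m) :
  (((cV_cons (z, y))^T *m cV_cons (z', y')) 0 0 = z * z' + (y^T *m y') 0 0)%R.
Proof.
rewrite !mxE big_ord_recl mxE !cV_cons0; congr (_ + _)%R.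
by apply: eq_bigr => i _; rewrite [_^T _ _]mxE [in RHS]mxE !cV_consS.
Qed.

Lemma std_normal_opp m (f : 'cV[R]_m -> \bar R) :
  measurable_fun setT f -> (forall x, 0 <= f x) ->
  \int[std_normal R m]_x f (- x)%R = \int[std_normal R m]_x f x.
Proof.
elim: m f => [|m IH] f mf f0.
  rewrite !std_normal_integral0 ?oppr0//.
  by apply: (measurableT_comp mf); exact: measurable_fun_oppmx.
have mfc z : measurable_fun setT (fun y => f (cV_cons (z, y))).
  by apply: (measurableT_comp mf); exact: measurable_cV_cons2.
have mfN : measurable_fun setT (fun x : 'cV[R]_m.+1 => f (- x)%R).
  by apply: (measurableT_comp mf); exact: measurable_fun_oppmx.
rewrite (std_normal_integralS mfN (fun x => f0 (- x)%R)) (std_normal_integralS mf f0).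
pose h z := \int[std_normal R m]_y f (cV_cons (z, y)).
have h0 z : 0 <= h z by apply: integral_ge0 => y _; exact: f0.
have mh : measurable_fun setT h.
  apply: (measurable_std_normal_section (F := f \o (@cV_cons R m))).
    by apply: (measurableT_comp mf); exact: measurable_cV_cons.
  by move=> u; exact: f0.
rewrite -[RHS](normal_prob_oppr mh h0).
apply: eq_integral => z _; rewrite /h -(IH _ (mfc _) (fun y => f0 _)).
by apply: eq_integral => y _; rewrite cV_consN.
Qed.

(** The one-dimensional shift applied one coordinate at a time; the weight factorises because [expR]
    turns sums into products. It later plays the role of the likelihood of an observation. *)
Lemma std_normal_cameron_martin m (f : 'cV[R]_m -> \bar R) (a : 'cV[R]_m) :
  measurable_fun setT f -> (forall x, 0 <= f x) ->
  \int[std_normal R m]_x f (x + a)%R =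
  \int[std_normal R m]_x
     (f x * (expR ((a^T *m x) 0 0 - sqnorm2 a / 2))%:E).
Proof.
have mexp k (b : 'cV[R]_k) :
    measurable_fun setT (fun x : 'cV[R]_k => (expR ((b^T *m x) 0 0 - sqnorm2 b / 2))%:E).
  apply/measurable_EFinP/measurableT_comp => //; apply: measurable_funB => //.
  exact: measurable_fun_dot.
elim: m f a => [|m IH] f a mf f0.
  rewrite !std_normal_integral0.
  - by rewrite [a]flatmx0 addr0 sqnorm2E mulmx0 mxE mul0r subr0 expR0 mule1.
  - exact: emeasurable_funM.
  - by apply: (measurableT_comp mf); exact: measurable_fun_addmx.
have mfc z : measurable_fun setT (fun y => f (cV_cons (z, y))).
  by apply: (measurableT_comp mf); exact: measurable_cV_cons2.
rewrite [a]cV_consE; move: (a ord0 0%R) (\col__ _)%R => a0 a' {a}.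
have mfa : measurable_fun setT (fun x : 'cV[R]_m.+1 => f (x + cV_cons (a0, a'))%R).
  by apply: (measurableT_comp mf); exact: measurable_fun_addmx.
rewrite (std_normal_integralS mfa (fun x => f0 _)).
rewrite std_normal_integralS; last 2 first.
- exact: emeasurable_funM.
- by move=> x; rewrite mule_ge0// lee_fin expR_ge0.
pose h z := \int[std_normal R m]_y
   (f (cV_cons (z, y)) * (expR ((a'^T *m y) 0 0 - sqnorm2 a' / 2))%:E).
transitivity (\int[normal_prob (0%R : R) 1]_z h (z + a0)%R).
  apply: eq_integral => z _; rewrite /h -(IH _ _ (mfc _) (fun y => f0 _)).
  by apply: eq_integral => y _; rewrite cV_consD.
have h0 z : 0 <= h z.
  by apply: integral_ge0 => y _; rewrite mule_ge0// lee_fin expR_ge0.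
have mh : measurable_fun setT h.
  apply: (measurable_std_normal_section (F := fun zy => f (cV_cons zy) *
    (expR ((a'^T *m zy.2) 0 0 - sqnorm2 a' / 2))%:E)).
    apply: emeasurable_funM.
      by apply: (measurableT_comp mf); exact: measurable_cV_cons.
    by apply: (measurableT_comp (mexp _ a')); exact: measurable_snd.
  by move=> zy; rewrite mule_ge0// lee_fin expR_ge0.
apply: etrans (normal_prob_shift a0 mh h0) _; apply: eq_integral => z _.
rewrite /h -ge0_integralZr.
- apply: eq_integral => y _; rewrite -muleA -EFinM -expRD.
  rewrite dot_cV_cons !sqnorm2E dot_cV_cons; congr (_ * (expR _)%:E).
  by ring.
- exact: measurableT.
- by apply: emeasurable_funM; [exact: mfc|exact: mexp].
- by move=> y _; rewrite mule_ge0// lee_fin expR_ge0.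
- by rewrite lee_fin expR_ge0.
Qed.

Lemma integral_std_normal_cst m (c : \bar R) :
  \int[std_normal R m]__ c = c.
Proof. by rewrite integral_cst//= probability_setT mule1. Qed.

(** Terms odd in [x] cancel between [x] and [- x]. Squares can thus be expanded and their cross
    terms dropped while only non-negative functions are integrated, with no integrability to
    check. *)
Lemma std_normal_avg m (f : 'cV[R]_m -> R) (g : 'cV[R]_m -> R) :
  measurable_fun setT f -> (forall x, 0 <= f x)%R ->
  (forall x, f x + f (- x) = 2 * g x)%R -> measurable_fun setT g ->
  \int[std_normal R m]_x (f x)%:E = \int[std_normal R m]_x (g x)%:E.
Proof.
move=> mf f0 fg mg.
have mfN : measurable_fun setT (fun x : 'cV[R]_m => f (- x)%R).
  by apply: (measurableT_comp mf); exact: measurable_fun_oppmx.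
have g0 x : (0 <= g x)%R by have := fg x; have := f0 x; have := f0 (- x)%R; lra.
have : \int[std_normal R m]_x (f x)%:E + \int[std_normal R m]_x (f x)%:E =
   2%:E * \int[std_normal R m]_x (g x)%:E.
  rewrite -{2}std_normal_opp//; last first.
    exact/measurable_EFinP.
  rewrite -ge0_integralD//; try exact/measurable_EFinP;
    try by move=> x _; rewrite lee_fin.
  transitivity (\int[std_normal R m]_x (2%:E * (g x)%:E)).
    by apply: eq_integral => x _; rewrite -EFinD fg EFinM.
  apply: ge0_integralZl => //; first exact/measurable_EFinP.
  by move=> x _; rewrite lee_fin.
have F0 : 0 <= \int[std_normal R m]_x (f x)%:E.
  by apply: integral_ge0 => x _; rewrite lee_fin.
have G0 : 0 <= \int[std_normal R m]_x (g x)%:E.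
  by apply: integral_ge0 => x _; rewrite lee_fin.
case: (\int[_]_x (f x)%:E) F0 => [r|//|//]; case: (\int[_]_x (g x)%:E) G0 => [s|//|//] s0 r0.
- by rewrite -EFinD -EFinM => -[rs]; congr (_%:E); lra.
- by rewrite mulry gtr0_sg ?mul1e.
- by rewrite -EFinM.
Qed.

Lemma std_normal_dot_sqr m (u : 'cV[R]_m) :
  \int[std_normal R m]_x (((u^T *m x) 0 0) ^+ 2)%R%:E = (sqnorm2 u)%:E.
Proof.
have mdot k (b : 'cV[R]_k) : measurable_fun setT (fun x : 'cV[R]_k => (b^T *m x) 0 0 ^+ 2)%R.
  by apply: measurable_funX; exact: measurable_fun_dot.
elim: m u => [|m IH] u.
  rewrite std_normal_integral0; last exact/measurable_EFinP.
  by rewrite mulmx0 mxE expr0n/= [u]flatmx0 sqnorm2E mulmx0 mxE.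
rewrite std_normal_integralS; first last.
- by move=> x; rewrite lee_fin sqr_ge0.
- exact/measurable_EFinP.
rewrite [u]cV_consE; move: (u ord0 0%R) (\col__ _)%R => u0 u' {u}.
rewrite sqnorm2E dot_cV_cons.
transitivity (\int[normal_prob (0%R : R) 1]_z
   ((u0 ^+ 2 * z ^+ 2)%R%:E + (sqnorm2 u')%:E)).
  apply: eq_integral => z _.
  rewrite (@std_normal_avg _ _ (fun y => (u0 * z) ^+ 2 + (u'^T *m y) 0 0 ^+ 2)%R).
  - under eq_integral do rewrite EFinD.
    rewrite ge0_integralD//; last 3 first.
    + by move=> x _; rewrite lee_fin sqr_ge0.
    + by move=> x _; rewrite lee_fin sqr_ge0.
    + exact/measurable_EFinP.
    by rewrite integral_std_normal_cst IH exprMn.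
  - under eq_fun do rewrite dot_cV_cons; apply: measurable_funX.
    by apply: measurable_funD => //; exact: measurable_fun_dot.
  - by move=> x; exact: sqr_ge0.
  - by move=> x; rewrite !dot_cV_cons dotNr; ring.
  - by apply: measurable_funD.
rewrite ge0_integralD//; first last.
- by move=> z _; rewrite lee_fin sqnorm2_ge0.
- by apply/measurable_EFinP; apply: measurable_funM => //; exact: exprn_measurable.
- by move=> z _; rewrite lee_fin mulr_ge0 ?sqr_ge0.
rewrite integral_cst//= probability_setT mule1.
under eq_integral do rewrite EFinM.
rewrite ge0_integralZl ?lee_fin ?sqr_ge0//; first last.
- by move=> z _; rewrite lee_fin sqr_ge0.
- by apply/measurable_EFinP; exact: exprn_measurable.
by rewrite normal_prob_sqr mule1 sqnorm2E.
Qed.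

(** Squared bias plus variance; it evaluates the noise average in the risk of a linear estimate and
    the average over a Gaussian prior. *)
Lemma std_normal_affine_sqnorm2 m p (c : 'cV[R]_p) (N : 'M[R]_(p, m)) :
  \int[std_normal R m]_x (sqnorm2 (c + N *m x))%:E =
  (sqnorm2 c + \tr (N^T *m N))%:E.
Proof.
have mN : measurable_fun setT (fun x : 'cV[R]_m => N *m x).
  exact: measurable_fun_mulmx.
rewrite (@std_normal_avg _ _ (fun x => sqnorm2 c + sqnorm2 (N *m x))%R); first last.
- by apply: measurable_funD => //; exact: measurable_fun_sqnorm2.
- by move=> x; rewrite mulmxN !sqnorm2D sqnorm2N dotNr; ring.
- by move=> x; exact: sqnorm2_ge0.
- by apply: measurable_fun_sqnorm2; exact: measurable_fun_addmx.
under eq_integral do rewrite EFinD.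
rewrite ge0_integralD//; first last.
- by apply/measurable_EFinP; exact: measurable_fun_sqnorm2.
- by move=> x _; rewrite lee_fin sqnorm2_ge0.
- by move=> x _; rewrite lee_fin sqnorm2_ge0.
rewrite integral_std_normal_cst EFinD; congr (_ + _).
rewrite mxtrace_gram_rows -sumEFin.
transitivity (\int[std_normal R m]_x
    \sum_(i < p) (((((row i N)^T)^T *m x) 0 0) ^+ 2)%R%:E).
  apply: eq_integral => x _; rewrite sumEFin; congr (_%:E).
  by apply: eq_bigr => i _; rewrite trmxK -row_mul [in RHS]mxE.
rewrite ge0_integral_sum//.
- by apply: eq_bigr => i _; rewrite std_normal_dot_sqr.
- move=> i; apply/measurable_EFinP; apply: measurable_funX.
  exact: measurable_fun_dot.
- by move=> i x _; rewrite lee_fin sqr_ge0.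
Qed.

(* Gaussian linearisation: [expR (t * s ^+ 2)] is the mean of
   [expR (sqrt (2 * t) * s * z)] over a standard normal [z]. *)
Lemma std_normal_exp_dot_sqr m (t : R) (u : 'cV[R]_m) :
  (0 <= t < 2^-1)%R -> sqnorm2 u = 1%R ->
  \int[std_normal R m]_x (expR (t * ((u^T *m x) 0 0) ^+ 2))%:E =
  ((Num.sqrt (1 - 2 * t))^-1)%R%:E.
Proof.
move=> /andP[t0 t2] u1.
pose c : R := Num.sqrt (2 * t).
have c2 : (c ^+ 2 = 2 * t)%R by rewrite sqr_sqrtr// mulr_ge0.
have mgf (k : R) : \int[normal_prob (0%R : R) 1]_z (expR (k * z))%:E =
    (expR (k ^+ 2 / 2))%:E.
  have := @normal_prob_shift R (fun=> 1%E) k (measurable_cst _) (fun=> lee01).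
  rewrite integral_cst//= probability_setT mul1e => /esym k1.
  have -> : \int[normal_prob (0%R : R) 1]_z (expR (k * z))%:E =
     \int[normal_prob (0%R : R) 1]_z ((expR (k ^+ 2 / 2))%:E *
        (1 * (expR (k * z - k ^+ 2 / 2))%:E)).
    apply: eq_integral => z _; rewrite mul1e -EFinM -expRD; congr (expR _)%:E.
    by ring.
  rewrite ge0_integralZl//.
  - by rewrite k1 mule1.
  - under eq_fun do rewrite mul1e; apply/measurable_EFinP/measurableT_comp => //.
    by apply: measurable_funB => //; exact: measurable_funM.
have mgfm (k : R) : \int[std_normal R m]_x (expR (k * (u^T *m x) 0 0))%:E =
    (expR (k ^+ 2 / 2))%:E.
  have := @std_normal_cameron_martin m (fun=> 1%E) (k *: u)%R (measurable_cst _) (fun=> lee01).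
  rewrite integral_std_normal_cst => /esym k1.
  have -> : \int[std_normal R m]_x (expR (k * (u^T *m x) 0 0))%:E =
     \int[std_normal R m]_x ((expR (k ^+ 2 / 2))%:E *
        (1 * (expR (((k *: u)^T *m x) 0 0 - sqnorm2 (k *: u) / 2))%:E)).
    apply: eq_integral => z _; rewrite mul1e -EFinM -expRD; congr (expR _)%:E.
    by rewrite sqnorm2Z u1 dotZl; ring.
  rewrite ge0_integralZl//.
  - by rewrite k1 mule1.
  - under eq_fun do rewrite mul1e; apply/measurable_EFinP/measurableT_comp => //.
    by apply: measurable_funB => //; exact: measurable_fun_dot.
rewrite -normal_prob_exp_sqr//.
transitivity (\int[std_normal R m]_x \int[normal_prob (0%R : R) 1]_z
    (expR (c * (u^T *m x) 0 0 * z))%:E).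
  apply: eq_integral => x _; rewrite mgf exprMn c2; congr (expR _)%:E.
  by field.
transitivity (\int[normal_prob (0%R : R) 1]_z \int[std_normal R m]_x
    (expR (c * z * (u^T *m x) 0 0))%:E); last first.
  apply: eq_integral => z _; rewrite mgfm exprMn c2; congr (expR _)%:E.
  by field.
rewrite (fubini_tonelli (fun xz : 'cV[R]_m * measurableTypeR R =>
   (expR (c * (u^T *m xz.1) 0 0 * xz.2))%:E)).
- apply: eq_integral => z _; apply: eq_integral => x _ /=.
  by rewrite mulrAC.
- apply/measurable_EFinP/measurableT_comp => //; apply: measurable_funM.
    by apply: measurable_funM => //; exact: measurable_fun_dot.
  exact: measurable_snd.
- by move=> xz; rewrite lee_fin expR_ge0.
Qed.

(* By convexity of [expR] in the weights of a rank-one decomposition of [W], the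
   rank-one case is the worst one. *)
Lemma std_normal_exp_qform m (W : 'M[R]_m) : psdmx W -> (\tr W < 2^-1)%R ->
  \int[std_normal R m]_x (expR (qform W x))%:E <=
  ((Num.sqrt (1 - 2 * \tr W))^-1)%R%:E.
Proof.
move=> /psdmx_factor[F ->]; set tau := \tr _ => tau2.
have tau0 : (0 <= tau)%R by exact: mxtrace_gram_ge0.
have [taueq|taun] := eqVneq tau 0%R.
  rewrite taueq mulr0 subr0 sqrtr1 invr1 (mxtrace_gram_eq0 taueq) mulmx0.
  under eq_integral do rewrite /qform mulmx0 mul0mx mxE expR0.
  by rewrite integral_std_normal_cst.
(* [W] is the sum of the [r i (r i)^T]; the weights [p i] are the shares of the trace and sum to 1.
   A zero row gets weight 0, and its [u i] is then 0 instead of a unit vector. *)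
pose r i := (row i F)^T; pose p i := (sqnorm2 (r i) / tau)%R.
pose u i := ((Num.sqrt (sqnorm2 (r i)))^-1 *: r i)%R.
have p0 i : (0 <= p i)%R by rewrite divr_ge0// sqnorm2_ge0.
have p1 : (\sum_i p i = 1)%R.
  by rewrite /p -mulr_suml -mxtrace_gram_rows divff.
have pu i (x : 'cV[R]_m) : (p i * (tau * ((u i)^T *m x) 0 0 ^+ 2) = ((r i)^T *m x) 0 0 ^+ 2)%R.
  have [r0|rn] := eqVneq (sqnorm2 (r i)) 0%R.
    by rewrite /p r0 !mul0r (sqnorm2_eq0 r0) trmx0 mul0mx mxE expr0n.
  rewrite /u dotZl exprMn exprVn sqr_sqrtr ?sqnorm2_ge0//.
  by rewrite /p; field; rewrite taun rn.
have u1 i : sqnorm2 (r i) != 0%R -> sqnorm2 (u i) = 1%R.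
  by move=> rn; rewrite sqnorm2Z exprVn sqr_sqrtr ?sqnorm2_ge0// mulVf.
have mexp i : measurable_fun setT
    (fun x : 'cV[R]_m => (expR (tau * ((u i)^T *m x) 0 0 ^+ 2))%:E).
  apply/measurable_EFinP/measurableT_comp => //; apply: measurable_funM => //.
  by apply: measurable_funX; exact: measurable_fun_dot.
have mW : measurable_fun setT (fun x : 'cV[R]_m => (expR (qform (F^T *m F) x))%:E).
  apply/measurable_EFinP/measurableT_comp => //.
  exact: (measurable_fun_qform _ (@measurable_id _ _ setT)).
have pe0 i (x : 'cV[R]_m) : 0 <= (p i)%:E * (expR (tau * ((u i)^T *m x) 0 0 ^+ 2))%:E.
  by rewrite -EFinM lee_fin mulr_ge0 ?p0 ?expR_ge0.
apply: (@le_trans _ _ (\int[std_normal R m]_x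
   \sum_i (p i)%:E * (expR (tau * ((u i)^T *m x) 0 0 ^+ 2))%:E)).
  apply: ge0_le_integral.
  - exact: measurableT.
  - by move=> x _; rewrite lee_fin expR_ge0.
  - exact: mW.
  - by apply: emeasurable_sum => i; apply: emeasurable_funM.
  move=> x _; under eq_bigr do rewrite -EFinM.
  rewrite sumEFin lee_fin.
  have -> : qform (F^T *m F) x = (\sum_i p i * (tau * ((u i)^T *m x) 0 0 ^+ 2))%R.
    rewrite -sqnorm2_mul; apply: eq_bigr => i _.
    by rewrite pu /r trmxK -row_mul [in RHS]mxE.
  set s := (\sum_i _)%R.
  (* Jensen through the tangent of [expR] at the weighted mean [s]: the linear corrections average
     to 0. *)
  rewrite [leLHS](_ : _ = \sum_i p i * (expR s *
      (1 + (tau * ((u i)^T *m x) 0 0 ^+ 2 - s))))%R.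
    apply: ler_sum => i _; apply: ler_wpM2l => //.
    set z := (tau * _)%R; rewrite -{2}[z](subrK s) [(_ - s + s)%R]addrC expRD.
    by rewrite ler_wpM2l ?expR_ge0// expR_ge1Dx.
  under eq_bigr => i _.
    rewrite (_ : (p i * _ = expR s * (p i * (1 - s) +
       p i * (tau * ((u i)^T *m x) 0 0 ^+ 2)))%R); last by ring.
    over.
  rewrite -mulr_sumr big_split/= -mulr_suml p1 -/s.
  by ring.
rewrite ge0_integral_sum; last 3 first.
- exact: measurableT.
- by move=> i; apply: emeasurable_funM.
- by move=> i x _; exact: pe0.
rewrite [leRHS](_ : _ = \sum_i (p i)%:E * ((Num.sqrt (1 - 2 * tau))^-1)%R%:E).
  rewrite (eq_bigr (fun i => (p i)%:E * ((Num.sqrt (1 - 2 * tau))^-1)%R%:E))//.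
  move=> i _; rewrite ge0_integralZl ?lee_fin//.
  have [r0|rn] := eqVneq (sqnorm2 (r i)) 0%R; first by rewrite /p r0 mul0r !mul0e.
  by rewrite std_normal_exp_dot_sqr ?u1// tau0.
under eq_bigr do rewrite -EFinM.
by rewrite sumEFin -mulr_suml p1 mul1r.
Qed.

End std_normal.

(** * Gaussian priors *)

Section bayes.
Context (R : realType) (m p : nat) (C : 'M[R]_(m, p)).
Local Open Scope ereal_scope.

(* The mean of [eta ~ N(0, I)] given [C eta + xi = omega] is [post_mean *m omega]. *)
Definition post_mean : 'M[R]_(p, m) := (invmx (1%:M + C^T *m C) *m C^T)%R.

(** The normal equations [(I + C^T C) mu = C^T xi] tested against [x]; they serve to complete the
    square in the posterior density. *)
Lemma post_meanP (x : 'cV[R]_p) (xi : 'cV[R]_m) :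
  (((C *m x)^T *m xi) 0 0 =
   ((C *m x)^T *m (C *m (post_mean *m xi))) 0 0 +
   (x^T *m (post_mean *m xi)) 0 0)%R.
Proof.
have uL : (1%:M + C^T *m C)%R \in unitmx.
  rewrite -row_free_unit -kermx_eq0; apply/rowV0P => v /sub_kermxP vL.
  have : ((v *m (1%:M + C^T *m C) *m v^T) 0 0 = 0)%R by rewrite vL mul0mx mxE.
  rewrite mulmxDr mulmx1 mulmxDl mxE -{1}(trmxK v) -sqnorm2E.
  have -> : (v *m (C^T *m C) *m v^T = (C *m v^T)^T *m (C *m v^T))%R.
    by rewrite trmx_mul trmxK !mulmxA.
  rewrite -sqnorm2E => v0; apply: trmx_inj; rewrite trmx0; apply: sqnorm2_eq0.
  by have := sqnorm2_ge0 v^T; have := sqnorm2_ge0 (C *m v^T); lra.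
transitivity ((x^T *m ((1%:M + C^T *m C) *m (post_mean *m xi))) 0 0)%R.
  by rewrite /post_mean -!mulmxA mulKVmx// trmx_mul mulmxA.
rewrite mulmxDl mul1mx mulmxDr mxE addrC; congr (_ + _)%R.
by rewrite trmx_mul !mulmxA.
Qed.

(** The density of [N(C eta, I)] relative to [N(0, I)] at [xi], that is, the likelihood of [eta]. *)
Let W (eta : 'cV[R]_p) (xi : 'cV[R]_m) : R :=
  expR (((C *m eta)^T *m xi) 0 0 - sqnorm2 (C *m eta) / 2)%R.

Let measurable_W : measurable_fun setT (fun ex : 'cV[R]_p * 'cV[R]_m => (W ex.1 ex.2)%:E).
Proof.
apply/measurable_EFinP/measurableT_comp => //.
have mC : measurable_fun setT (fun ex : 'cV[R]_p * 'cV[R]_m => C *m ex.1)%R.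
  by apply: measurable_fun_mulmx; exact: measurable_fst.
apply: measurable_funB; first by apply: measurable_fun_dot => //; exact: measurable_snd.
by apply: measurable_funM => //; exact: measurable_fun_sqnorm2.
Qed.

(* The posterior density of [eta] is proportional to
   [W eta xi * expR (- sqnorm2 eta / 2)], which is symmetric about its mean. *)
Let posterior_symmetric (k : 'cV[R]_p -> \bar R) (xi : 'cV[R]_m) :
  measurable_fun setT k -> (forall eta, 0 <= k eta) ->
  \int[std_normal R p]_eta (k eta * (W eta xi)%:E) =
  \int[std_normal R p]_eta
    (k (2 *: (post_mean *m xi) - eta)%R * (W eta xi)%:E).
Proof.
move=> mk k0; pose mu := (post_mean *m xi)%R.
have mW : measurable_fun setT (fun eta => (W eta xi)%:E).
  have mx : measurable_fun setT (fun eta : 'cV[R]_p => (eta, xi)).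
    exact: measurable_fun_pair.
  exact: (measurableT_comp measurable_W mx).
pose h eta := k eta * (W eta xi)%:E.
have mh : measurable_fun setT h by exact: emeasurable_funM.
have h0 eta : 0 <= h eta by rewrite mule_ge0// lee_fin expR_ge0.
rewrite -/(h _) -[LHS](std_normal_opp mh h0).
(* Reflection about [mu] is a sign change combined with a translation by [2 mu]. The function [f]
   divides out the Cameron-Martin weight of the translation in advance. *)
pose a := (- (2 *: mu))%R.
pose f eta := h (- eta)%R * (expR (sqnorm2 a / 2 - (a^T *m eta) 0 0))%:E.
transitivity (\int[std_normal R p]_eta
    (f eta * (expR ((a^T *m eta) 0 0 - sqnorm2 a / 2))%:E)).
  apply: eq_integral => eta _; rewrite /f -muleA -EFinM -expRD.
  by rewrite addrA subrK subrr expR0 mule1.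
rewrite -std_normal_cameron_martin; first last.
- by move=> eta; rewrite mule_ge0// lee_fin expR_ge0.
- apply: emeasurable_funM.
    by apply: (measurableT_comp mh); exact: measurable_fun_oppmx.
  apply/measurable_EFinP/measurableT_comp => //; apply: measurable_funB => //.
  exact: measurable_fun_dot.
apply: eq_integral => eta _; rewrite /f /h opprD opprK addrC.
rewrite -muleA -EFinM -expRD; congr (_ * (expR _)%:E).
have Peta := post_meanP eta xi; have Pmu := post_meanP mu xi.
rewrite -/mu in Peta Pmu.
have -> : (C *m (2 *: mu - eta) = 2 *: (C *m mu) - C *m eta)%R.
  by rewrite mulmxBr -scalemxAr.
rewrite /a !sqnorm2E !(dotDl, dotDr, dotNl, dotNr, dotZl, dotZr) Peta Pmu.
rewrite (dotC (C *m mu) (C *m eta)) (dotC mu eta).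
by field.
Qed.

(** Replacing the signal by its reflection about the posterior mean preserves the joint law of
    signal and observation. Changing measure in the noise and exchanging the integrals leaves, for
    each fixed observation, an unnormalised posterior integral, which [posterior_symmetric]
    treats. *)
Lemma bayes_reflection (F : 'cV[R]_p * 'cV[R]_m -> \bar R) :
  measurable_fun setT F -> (forall ex, 0 <= F ex) ->
  \int[std_normal R p \x std_normal R m]_ex F (ex.1, ex.2 + C *m ex.1)%R =
  \int[std_normal R p \x std_normal R m]_ex
    F (2 *: (post_mean *m (ex.2 + C *m ex.1)) - ex.1, ex.2 + C *m ex.1)%R.
Proof.
move=> mF F0.
have weight (G : 'cV[R]_p * 'cV[R]_m -> \bar R) :
    measurable_fun setT G -> (forall ex, 0 <= G ex) ->
    \int[std_normal R p \x std_normal R m]_ex G (ex.1, ex.2 + C *m ex.1)%R =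
    \int[std_normal R m]_xi \int[std_normal R p]_eta
       (G (eta, xi) * (W eta xi)%:E).
  move=> mG G0; rewrite fubini_tonelli1; first last.
  - by move=> ex; exact: G0.
  - apply: (measurableT_comp mG); apply: measurable_fun_pair; first exact: measurable_fst.
    apply: measurable_fun_addmx; first exact: measurable_snd.
    by apply: measurable_fun_mulmx; exact: measurable_fst.
  rewrite -(fubini_tonelli (fun ex : 'cV[R]_p * 'cV[R]_m => G ex * (W ex.1 ex.2)%:E)).
  - apply: eq_integral => eta _; rewrite /fubini_F /=.
    apply: (@std_normal_cameron_martin _ _ (fun xi => G (eta, xi))) => //.
    by apply: (measurableT_comp mG); exact: measurable_fun_pair.
  - exact: emeasurable_funM.
  - by move=> ex; rewrite mule_ge0// lee_fin expR_ge0.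
rewrite (weight _ mF F0).
rewrite (weight (fun ex => F (2 *: (post_mean *m ex.2) - ex.1, ex.2)%R)).
- apply: eq_integral => xi _; apply: (@posterior_symmetric (fun eta => F (eta, xi))) => //.
  by apply: (measurableT_comp mF); exact: measurable_fun_pair.
- apply: (measurableT_comp mF); apply: measurable_fun_pair; last exact: measurable_snd.
  apply: measurable_fun_addmx; last by apply: measurable_fun_oppmx; exact: measurable_fst.
  apply: measurable_fun_scalemx; first exact: measurable_cst.
  apply: measurable_fun_mulmx.
  exact: measurable_snd.
- by move=> ex; exact: F0.
Qed.

End bayes.

(** * Linear estimates and the Bayes risk under a Gaussian prior *)

Section bayes_risk.
Context (R : realType) (m n nu p : nat).
Variables (A : 'M[R]_(m, n)) (B : 'M[R]_(nu, n)) (sigma : R) (G : 'M[R]_(n, p)).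
Hypothesis sigma0 : 0 < sigma.
Local Open Scope ereal_scope.

(** [H] is the posterior mean of [B x]. A signal and its reflection yield the same observation,
    hence the same value of [w]; by the parallelogram law the average of the two losses is at least
    the squared distance of [B x] from its posterior mean, whose expectation is the risk of [H]. *)
Lemma bayes_risk_lower (w : 'cV[R]_m -> 'cV[R]_nu) : measurable_fun setT w ->
  exists H, (lin_risk2 A B sigma H (G *m G^T)%R)%:E <=
  \int[std_normal R p]_eta \int[std_normal R m]_xi
    (sqnorm2 (w (A *m (G *m eta) + sigma *: xi) - B *m (G *m eta))%R)%:E.
Proof.
move=> mw.
(* The observation divided by [sigma] is [xi + C eta], with unit noise; this explains the factors
   [sigma] in [F] and [sigma^-1] in [H]. *)
pose C := (sigma^-1 *: (A *m G))%R.
pose M := post_mean C; pose BG := (B *m G)%R.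
pose H := ((sigma^-1 *: (BG *m M))^T)%R; exists H.
pose P := (std_normal R p \x std_normal R m).
pose F (ex : 'cV[R]_p * 'cV[R]_m) := (sqnorm2 (w (sigma *: ex.2) - BG *m ex.1)%R)%:E.
pose Z (ex : 'cV[R]_p * 'cV[R]_m) := (sqnorm2 (BG *m (ex.1 - M *m ex.2))%R)%:E.
pose sh (ex : 'cV[R]_p * 'cV[R]_m) := (ex.1, ex.2 + C *m ex.1)%R.
pose rf (ex : 'cV[R]_p * 'cV[R]_m) := (2 *: (M *m ex.2) - ex.1, ex.2)%R.
have F0 ex : 0 <= F ex by rewrite lee_fin sqnorm2_ge0.
have Z0 ex : 0 <= Z ex by rewrite lee_fin sqnorm2_ge0.
have mM : measurable_fun setT (fun ex : 'cV[R]_p * 'cV[R]_m => M *m ex.2)%R.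
  by apply: measurable_fun_mulmx; exact: measurable_snd.
have mF : measurable_fun setT F.
  apply/measurable_EFinP; apply: measurable_fun_sqnorm2.
  apply: measurable_fun_addmx; last first.
    apply: measurable_fun_oppmx; apply: measurable_fun_mulmx; exact: measurable_fst.
  apply: (measurableT_comp mw); apply: measurable_fun_scalemx.
    exact: measurable_cst.
  exact: measurable_snd.
have mZ : measurable_fun setT Z.
  apply/measurable_EFinP; apply: measurable_fun_sqnorm2.
  apply: measurable_fun_mulmx; apply: measurable_fun_addmx; first exact: measurable_fst.
  exact: measurable_fun_oppmx.
have msh : measurable_fun setT sh.
  apply: measurable_fun_pair; first exact: measurable_fst.
  apply: measurable_fun_addmx; first exact: measurable_snd.
  by apply: measurable_fun_mulmx; exact: measurable_fst.
have mrf : measurable_fun setT rf.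
  apply: measurable_fun_pair; last exact: measurable_snd.
  apply: measurable_fun_addmx; last by apply: measurable_fun_oppmx; exact: measurable_fst.
  by apply: measurable_fun_scalemx => //; exact: measurable_cst.
have eqF : \int[P]_ex F (sh ex) = \int[P]_ex F (rf (sh ex)).
  exact: (bayes_reflection C mF F0).
(* [w - BG eta] and [w - BG (2 mean - eta)] are [v - zeta] and [v + zeta]. *)
have avg ex : 2%:E * Z ex <= F ex + F (rf ex).
  rewrite /Z /F /rf/= -EFinM -EFinD lee_fin.
  set v := w _.
  have -> : (v - BG *m ex.1 = (v - BG *m (M *m ex.2)) - BG *m (ex.1 - M *m ex.2))%R.
    by rewrite mulmxBr opprB addrA subrK.
  have -> : (v - BG *m (2 *: (M *m ex.2) - ex.1) =
      (v - BG *m (M *m ex.2)) + BG *m (ex.1 - M *m ex.2))%R.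
    by rewrite !mulmxBr scaler_nat mulr2n mulmxDr opprB !opprD !addrA addrAC.
  set y := (v - _)%R; set z := (BG *m (_ - _))%R; clearbody y z.
  rewrite !sqnorm2D sqnorm2N dotNr.
  by have := sqnorm2_ge0 y; lra.
have eqZ : \int[P]_ex Z (sh ex) = (lin_risk2 A B sigma H (G *m G^T)%R)%:E.
  rewrite fubini_tonelli1; [|exact: measurableT_comp|by move=> ex; exact: Z0].
  rewrite /fubini_F /Z /sh/=.
  have ZE (eta : 'cV[R]_p) (xi : 'cV[R]_m) : (BG *m (eta - M *m (xi + C *m eta)) =
      ((B - H^T *m A) *m G) *m eta + (- (sigma *: H^T)) *m xi)%R.
    rewrite /H trmxK scalerA divff ?gt_eqF// scale1r.
    rewrite mulmxBr mulmxDr [(BG *m (_ + _))%R]mulmxDr opprD.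
    rewrite mulmxBl mulmxBl mulNmx addrA addrAC; congr (_ - _ - _)%R.
      by rewrite /C -!(scalemxAl, scalemxAr) !mulmxA.
    exact: mulmxA.
  transitivity (\int[std_normal R p]_eta
      ((sqnorm2 (0 + ((B - H^T *m A) *m G) *m eta)%R)%:E +
       (sigma ^+ 2 * \tr (H^T *m H))%R%:E)).
    apply: eq_integral => eta _.
    under eq_integral do rewrite ZE.
    rewrite std_normal_affine_sqnorm2 EFinD add0r; congr (_ + _%:E).
    have -> : ((- (sigma *: H^T))^T = - (sigma *: H))%R.
      by rewrite linearN/= linearZ/= trmxK.
    rewrite mulNmx mulmxN opprK -scalemxAl -scalemxAr.
    by rewrite !mxtraceZ mulrA -expr2 mxtrace_mulC.
  rewrite ge0_integralD//; first last.
  - by move=> eta _; rewrite lee_fin mulr_ge0 ?sqr_ge0 ?mxtrace_gram_ge0.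
  - apply/measurable_EFinP; apply: measurable_fun_sqnorm2.
    by apply: measurable_fun_addmx => //; exact: measurable_fun_mulmx.
  - by move=> eta _; rewrite lee_fin sqnorm2_ge0.
  rewrite std_normal_affine_sqnorm2 integral_std_normal_cst -EFinD; congr (_%:E).
  rewrite /lin_risk2; congr (_ + _)%R.
  rewrite sqnorm2E mulmx0 mxE add0r mxtrace_mulC trmx_mul.
  by rewrite !mulmxA.
have LHSE : \int[std_normal R p]_eta \int[std_normal R m]_xi
    (sqnorm2 (w (A *m (G *m eta) + sigma *: xi) - B *m (G *m eta))%R)%:E =
    \int[P]_ex F (sh ex).
  rewrite fubini_tonelli1; [|exact: measurableT_comp|by move=> ex; exact: F0].
  apply: eq_integral => eta _; apply: eq_integral => xi _; rewrite /F /sh/=.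
  rewrite scalerDr /C -scalemxAl scalerA divff ?gt_eqF// scale1r.
  by rewrite [(sigma *: xi + _)%R]addrC /BG !mulmxA.
rewrite LHSE -eqZ.
have le2 : 2%:E * \int[P]_ex Z (sh ex) <= \int[P]_ex F (sh ex) + \int[P]_ex F (sh ex).
  rewrite {2}eqF -ge0_integralD//; last 2 first.
  - exact: measurableT_comp.
  - by apply: measurableT_comp => //; exact: measurableT_comp.
  rewrite -ge0_integralZl//; last exact: measurableT_comp.
  apply: ge0_le_integral => //.
  - by move=> ex _; rewrite mule_ge0.
  - by apply: emeasurable_funM => //; exact: measurableT_comp.
  - apply: emeasurable_funD; first exact: measurableT_comp.
    by apply: measurableT_comp => //; exact: measurableT_comp.
have : 0 <= \int[P]_ex F (sh ex) by apply: integral_ge0 => ex _; exact: F0.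
move: le2; rewrite eqZ; case: (\int[P]_ex F (sh ex)) => [r| |] //.
  by rewrite -EFinM -EFinD !lee_fin => ? _; lra.
by move=> _ _; rewrite leey.
Qed.

End bayes_risk.

(** * Near-optimality *)

(** Makes the logarithm of a number at least 8 an admissible [L]. The bound [expR (1/16) <= 16/15]
    follows from [1 - 1/16 <= expR (- 1/16)] and is squared five times with rational rounding. *)
Lemma expR2_le8 (R : realType) : expR 2 <= 8 :> R.
Proof.
have e1 : expR (16^-1) <= 16 / 15 :> R.
  have := @expR_ge1Dx R (- 16^-1); rewrite expRN => h.
  rewrite -[leLHS]invrK -[leRHS]invrK lef_pV2 ?posrE ?invr_gt0 ?expR_gt0 ?divr_gt0//.
  by rewrite (_ : (16 / 15)^-1 = 1 - 16^-1) ?opprK//; field.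
have sq (a b c : R) : 0 < a -> a <= b -> b ^+ 2 <= c -> a ^+ 2 <= c.
  by move=> a0 ab bc; apply: le_trans bc; rewrite lerXn2r ?nnegrE ?(ltW a0)// (le_trans (ltW a0)).
have -> : expR 2 = ((((expR (16^-1) ^+ 2) ^+ 2) ^+ 2) ^+ 2) ^+ 2 :> R.
  by rewrite -!exprM -expRM_natl; congr expR; field.
have p0 := @expR_gt0 R (16^-1).
apply: (sq _ (281 / 100)); [by rewrite !exprn_gt0| |by lra].
apply: (sq _ (1676 / 1000)); [by rewrite !exprn_gt0| |by lra].
apply: (sq _ (12946 / 10000)); [by rewrite !exprn_gt0| |by lra].
apply: (sq _ (11378 / 10000)); [by rewrite !exprn_gt0| |by lra].
by apply: (sq _ (16 / 15)) => //; lra.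
Qed.

(** * Projection of estimates onto a ball *)

Section truncation.
Context (R : realType) (nu : nat) (M : R).
Hypothesis M0 : 0 <= M.
Implicit Types v b : 'cV[R]_nu.

(** The metric projection onto the closed ball of radius [M]. The maximum covers points inside and
    outside in one formula, convenient for measurability; for [M = 0] it is the zero map. *)
Definition ball_proj v := (M / Num.max M (Num.sqrt (sqnorm2 v))) *: v.

Lemma measurable_ball_proj d (U : measurableType d) (f : U -> 'cV[R]_nu) :
  measurable_fun setT f -> measurable_fun setT (fun u => ball_proj (f u)).
Proof.
move=> mf; apply: measurable_fun_scalemx => //.
apply: measurable_funM => //.
pose h u := Num.max M (Num.sqrt (sqnorm2 (f u))).
have mh : measurable_fun setT h.
  apply: measurable_maxr => //.
  apply: (measurableT_comp (continuous_measurable_fun (@sqrt_continuous R))).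
  exact: measurable_fun_sqnorm2.
rewrite (_ : (fun u => _) = (@powR R ^~ (-1)) \o h).
  by apply: (measurableT_comp _ mh); exact: measurable_powR.
by apply/funext => u; rewrite /= powR_inv1// le_max M0.
Qed.

Let sqrtK v : Num.sqrt (sqnorm2 v) ^+ 2 = sqnorm2 v.
Proof. by rewrite sqr_sqrtr// sqnorm2_ge0. Qed.

Lemma sqnorm2_ball_proj_le v : sqnorm2 (ball_proj v) <= M ^+ 2.
Proof.
rewrite sqnorm2Z; set s := Num.sqrt _.
have s0 : 0 <= s by exact: sqrtr_ge0.
rewrite -sqrtK -/s -exprMn ler_sqr ?nnegrE ?mulr_ge0 ?invr_ge0 ?le_max ?M0//.
have [->|mn] := eqVneq (Num.max M s) 0; first by rewrite invr0 mulr0 mul0r.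
have m0 : 0 < Num.max M s by rewrite lt_def mn le_max M0.
by rewrite mulrAC ler_pdivrMr// ler_wpM2l// le_max lexx orbT.
Qed.

Lemma ball_proj_closer v b : sqnorm2 b <= M ^+ 2 ->
  sqnorm2 (ball_proj v - b) <= sqnorm2 (v - b).
Proof.
move=> bM; rewrite /ball_proj; set s := Num.sqrt _.
have s0 : 0 <= s by exact: sqrtr_ge0.
have s2 : s ^+ 2 = sqnorm2 v by exact: sqrtK.
have [sM|Ms] := leP s M.
  have [Meq|Mn] := eqVneq M 0.
    have v0 : v = 0.
      apply: sqnorm2_eq0; rewrite -s2 (_ : s = 0) ?expr0n//.
      by apply/eqP; rewrite eq_le s0 andbT -Meq.
    by rewrite v0 scaler0.
  by rewrite divff// scale1r.
have sgt0 : 0 < s by exact: le_lt_trans Ms.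
have vb : (v^T *m b) 0 0 <= s * M.
  apply: le_trans (ler_norm _) _.
  rewrite -(@ler_sqr _ `|_|) ?nnegrE ?mulr_ge0// real_normK ?num_real//.
  rewrite exprMn s2; apply: le_trans (cauchy_schwarz _ _) _.
  by rewrite ler_wpM2l// sqnorm2_ge0.
rewrite !sqnorm2D !dotNr dotZl sqnorm2Z -s2.
set t := (v^T *m b) 0 0 in vb *; set a := M / s.
have aE : M = a * s by rewrite /a divfK// gt_eqF.
have a1 : a < 1 by rewrite /a ltr_pdivrMr// mul1r.
have a0 : 0 <= a by rewrite divr_ge0.
rewrite {}aE in vb.
(* The difference of the two squared distances is twice the quantity in [h1] plus the one in
   [h2]. *)
have h1 : 0 <= (1 - a) * (s * (a * s) - t) by rewrite mulr_ge0 ?subr_ge0// ltW.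
have h2 : 0 <= (1 - a) ^+ 2 * s ^+ 2 by rewrite mulr_ge0 ?sqr_ge0.
by nra.
Qed.

Lemma sqnorm2B_le v b : sqnorm2 (v - b) <= 2 * sqnorm2 v + 2 * sqnorm2 b.
Proof.
have := sqnorm2_ge0 (v + b); rewrite !sqnorm2D dotNr sqnorm2N; lra.
Qed.

End truncation.

(** * Risk bounds over an ellitope *)

Section optimality.
Context (R : realType) (m n nu K : nat).
Variables (A : 'M[R]_(m, n)) (B : 'M[R]_(nu, n)) (sigma : R).
Variables (S : 'I_K -> 'M[R]_n) (T : set 'cV[R]_K).
Hypothesis (sigma0 : 0 < sigma) (ST : ellitope_data S T).
Local Notation X := (ellitope S T).
Local Notation M := (Mstar B S T).

Lemma mxtrace_bilin_gram p (G : 'M[R]_(n, p)) :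
  \tr (B *m (G *m G^T) *m B^T) = \tr ((B *m G)^T *m (B *m G)).
Proof. by rewrite [RHS]mxtrace_mulC trmx_mul !mulmxA. Qed.

Lemma mxtrace_cyc p (G : 'M[R]_(n, p)) (P : 'M[R]_n) :
  \tr (G *m G^T *m P) = \tr (G^T *m P *m G).
Proof. by rewrite -mulmxA mxtrace_mulC. Qed.

(** By coercivity [B^T B] is below a multiple of the sum of the [S k], and pairing with [Q] leaves
    coordinates of a point of the bounded set [T]. This ensures that the total [sup] in [Mstar] is a
    genuine supremum. *)
Lemma Mstar_ubound :
  has_ubound [set \tr (B *m Q *m B^T) | Q in matrix_ellitope S T].
Proof.
have [kap kap0 kapP] := pdmx_coercive (ellitope_pd ST).
have [b b0 Tb] := ellitope_bounded ST.
pose c := \tr (B^T *m B) * kap.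
have c0 : 0 <= c by rewrite mulr_ge0// mxtrace_gram_ge0.
exists (c * \sum_(k < K) b) => _ [Q [pQ [t Tt Qt]] <-].
have [F FE] := psdmx_factor pQ.
have {FE} : Q = F^T *m (F^T)^T by rewrite trmxK.
move: (F^T) => G QE.
have pc : psdmx (c *: \sum_k S k - B^T *m B).
  split.
    apply/symmetricmxP; rewrite linearB/= linearZ/= trmx_mul trmxK; congr (_ *: _ - _).
    rewrite linear_sum/=; apply: eq_bigr => k _.
    exact: psdmx_sym (ellitope_psd ST k).
  move=> x; rewrite -/(qform _ _) qformD qformN -sqnorm2_mul subr_ge0 qformZ.
  rewrite (le_trans (sqnorm2_mul_le _ _))// /c -mulrA.
  by rewrite ler_wpM2l// mxtrace_gram_ge0.
have := psdmx_trace_ge0 (psdmx_congr G pc).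
rewrite -mxtrace_cyc -QE mulmxBr linearB/= -scalemxAr mxtraceZ subr_ge0.
have -> : \tr (Q *m (B^T *m B)) = \tr (B *m Q *m B^T).
  by rewrite mulmxA mxtrace_mulC mulmxA.
move=> /le_trans; apply; rewrite ler_wpM2l// mulmx_sumr linear_sum/=.
apply: ler_sum => k _; apply: le_trans (Qt k) _.
by have /andP[] := Tb t Tt k.
Qed.

Lemma matrix_ellitope0 : matrix_ellitope S T 0.
Proof.
split; first exact: psdmx0.
have [t Tt] := ellitope_nonempty ST; exists t => // k.
by rewrite mul0mx mxtrace0; exact: (ellitope_orthant ST Tt).
Qed.

Lemma Mstar_ge Q : matrix_ellitope S T Q -> \tr (B *m Q *m B^T) <= M ^+ 2.
Proof.
move=> QQ; rewrite sqr_sqrtr.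
  by apply: ub_le_sup; [exact: Mstar_ubound|exists Q].
apply: ub_le_sup; first exact: Mstar_ubound.
by exists 0; [exact: matrix_ellitope0|rewrite mulmx0 mul0mx mxtrace0].
Qed.

(** The rank-one matrix [x x^T] belongs to the matrix ellitope. *)
Lemma ellitope_Mstar x : X x -> sqnorm2 (B *m x) <= M ^+ 2.
Proof.
move=> [t Tt xt].
have -> : sqnorm2 (B *m x) = \tr (B *m (x *m x^T) *m B^T).
  by rewrite mxtrace_bilin_gram trace_mx11 sqnorm2E.
apply: Mstar_ge; split; first by rewrite -{1}(trmxK x); exact: psdmx_gram.
by exists t => // k; rewrite mxtrace_cyc trace_mx11.
Qed.

Lemma ellitope0 : X 0.
Proof.
have [t Tt] := ellitope_nonempty ST; exists t => // k.
by rewrite mulmx0 mxE; exact: (ellitope_orthant ST Tt).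
Qed.

(** The variance is the first term of the objective. The matrix constraint bounds the squared bias
    at [x] by the sum of the [l k 0 * qform (S k) x], hence by [l^T t] and by the support
    function. *)
Lemma risk_linear_le (H : 'M[R]_(m, nu)) (l : 'cV[R]_K) :
  design_feasible A B S (H, l) ->
  (risk A B sigma X (linear_estimate H) <=
   (Num.sqrt (design_objective sigma T (H, l)))%:E)%E.
Proof.
move=> [[_ fS] l0]; apply: ge_ereal_sup => _ [x [t Tt xt] <-].
rewrite unlock.
have -> : (\int[std_normal R m]_xi
     (sqnorm2 (linear_estimate H (A *m x + sigma *: xi) - B *m x))%:E =
   (sqnorm2 ((B - H^T *m A) *m x) + sigma ^+ 2 * \tr (H^T *m H))%:E)%E.
  have E (xi : 'cV[R]_m) : linear_estimate H (A *m x + sigma *: xi) - B *m x =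
      - ((B - H^T *m A) *m x) + (sigma *: H^T) *m xi.
    rewrite /linear_estimate mulmxDr mulmxBl opprB -scalemxAr -scalemxAl mulmxA.
    by rewrite addrAC.
  under eq_integral do rewrite E.
  rewrite std_normal_affine_sqnorm2 sqnorm2N; congr (_ + _)%:E.
  have -> : (sigma *: H^T)^T = sigma *: H by rewrite linearZ/= trmxK.
  by rewrite -scalemxAl -scalemxAr !mxtraceZ mulrA -expr2 mxtrace_mulC.
rewrite /= lee_fin; apply: ler_wsqrtr; rewrite /design_objective/= addrC lerD2l.
have := fS x; rewrite -/(qform _ _) qformD qformN -sqnorm2_mul subr_ge0 => /le_trans.
apply; rewrite qform_sum.
apply: le_trans (support_fun_ge ST l Tt); apply: ler_sum => k _.
by rewrite qformZ; apply: ler_wpM2l; [exact: l0|exact: xt].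
Qed.

(* The prior is [N(0, Q / (4 L))]; [e1 k] dominates the indicator of the event
   that the [k]-th constraint fails, times the loss there. *)
Lemma bayes_risk_upper (w : 'cV[R]_m -> 'cV[R]_nu) (c L : R) Q :
  measurable_fun setT w -> 0 <= c -> 2 <= L -> matrix_ellitope S T Q ->
  (forall x, X x -> (\int[std_normal R m]_xi
     (sqnorm2 (w (A *m x + sigma *: xi) - B *m x))%:E <= (c ^+ 2)%:E)%E) ->
  exists H, lin_risk2 A B sigma H ((4 * L)^-1 *: Q) <=
    c ^+ 2 + 4 * K%:R * M ^+ 2 * expR (- L).
Proof.
move=> mw c0 L2 QQ wc; have [pQ [t Tt Qt]] := QQ.
have M0 : 0 <= M by exact: sqrtr_ge0.
pose rho := (4 * L)^-1.
have rho0 : 0 < rho by rewrite invr_gt0; lra.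
have [F FE] := psdmx_factor (psdmxZ (ltW rho0) pQ).
have {FE} : rho *: Q = F^T *m (F^T)^T by rewrite trmxK.
move: (F^T) => G QE.
pose w' v := ball_proj M (w v).
have mw' : measurable_fun setT w' by exact: measurable_ball_proj.
have [H HB] := bayes_risk_lower A B G sigma0 mw'.
exists H; rewrite -/rho QE -lee_fin; apply: le_trans HB _.
(* Where constraint [k] fails, the first term is at least [L] and offsets [expR (- L)]; the second
   absorbs the loss through [1 + u <= expR u]. *)
pose W k := (L / t k 0) *: (G^T *m S k *m G) + M ^- 2 *: ((B *m G)^T *m (B *m G)).
have t0 k : 0 <= t k 0 := ellitope_orthant ST Tt k.
have pW k : psdmx (W k).
  apply: psdmxD; apply: psdmxZ.
  - by rewrite divr_ge0//; lra.
  - exact: psdmx_congr (ellitope_psd ST k).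
  - by rewrite invr_ge0 exprn_ge0.
  - exact: psdmx_gram.
have trS k : \tr (G^T *m S k *m G) <= rho * t k 0.
  rewrite -mxtrace_cyc -QE -scalemxAl mxtraceZ ler_wpM2l ?(ltW rho0)//.
have trB : \tr ((B *m G)^T *m (B *m G)) <= rho * M ^+ 2.
  rewrite -mxtrace_bilin_gram -QE -scalemxAr -scalemxAl mxtraceZ.
  by rewrite ler_wpM2l ?(ltW rho0)// Mstar_ge.
(* The first term contributes at most [L * rho = 1/4] and the second at most [rho <= 1/8], as
   [L >= 2]. Zero values of [t k 0] or [M] only turn a coefficient into 0. *)
have trW k : \tr (W k) <= 3 / 8.
  rewrite mxtraceD !mxtraceZ.
  have h1 : L / t k 0 * \tr (G^T *m S k *m G) <= L * rho.
    have [teq|tn] := eqVneq (t k 0) 0.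
      by rewrite teq invr0 mulr0 mul0r mulr_ge0 ?(ltW rho0)//; lra.
    have tgt : 0 < t k 0 by rewrite lt_def tn t0.
    rewrite -mulrA ler_wpM2l//; first lra.
    by rewrite mulrC ler_pdivrMr.
  have h2 : M ^- 2 * \tr ((B *m G)^T *m (B *m G)) <= rho.
    have [Meq|Mn] := eqVneq M 0; first by rewrite Meq expr0n/= invr0 mul0r ltW.
    by rewrite mulrC ler_pdivrMr// exprn_gt0// lt_def Mn M0.
  have h3 : rho <= 8^-1 by rewrite /rho lef_pV2 ?posrE//; lra.
  have h4 : L * rho = 4^-1 by rewrite /rho; field; lra.
  by lra.
pose e1 k (eta : 'cV[R]_n) : R := 2 * M ^+ 2 * expR (- L) * expR (qform (W k) eta).
have e10 k eta : 0 <= e1 k eta by rewrite !mulr_ge0 ?expR_ge0 ?sqr_ge0.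
have mexp k : measurable_fun setT (fun eta => (expR (qform (W k) eta))%:E).
  apply/measurable_EFinP/measurableT_comp => //.
  exact: (measurable_fun_qform _ (@measurable_id _ _ setT)).
have me1 k : measurable_fun setT (fun eta => (e1 k eta)%:E).
  apply/measurable_EFinP; apply: measurable_funM => //.
  by apply/measurable_EFinP; exact: mexp.
have ptw eta : (\int[std_normal R m]_xi
    (sqnorm2 (w' (A *m (G *m eta) + sigma *: xi) - B *m (G *m eta)))%:E <=
    (c ^+ 2)%:E + \sum_k (e1 k eta)%:E)%E.
  have mint (v : 'cV[R]_m -> 'cV[R]_nu) : measurable_fun setT v ->
      measurable_fun setT (fun xi : 'cV[R]_m =>
        (sqnorm2 (v (A *m (G *m eta) + sigma *: xi) - B *m (G *m eta)))%:E).
    move=> mv; apply/measurable_EFinP; apply: measurable_fun_sqnorm2.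
    apply: measurable_fun_addmx => //.
    apply: (measurableT_comp mv); apply: measurable_fun_addmx => //.
    by apply: measurable_fun_scalemx => //; exact: measurable_id.
  have sume0 : (0 <= \sum_k (e1 k eta)%:E)%E.
    by apply: sume_ge0 => k _; rewrite lee_fin.
  have [Xx|nX] := pselect (X (G *m eta)).
    apply: (@le_trans _ _ (c ^+ 2)%:E); last by rewrite leeDl.
    apply: le_trans (wc _ Xx); apply: ge0_le_integral.
    - exact: measurableT.
    - by move=> xi _; rewrite lee_fin sqnorm2_ge0.
    - exact: mint.
    - exact: mint.
    - move=> xi _; rewrite lee_fin; apply: ball_proj_closer => //.
      exact: ellitope_Mstar.
  have [k kt] : exists k, t k 0 < qform (S k) (G *m eta).
    apply: contrapT => nk; apply: nX; exists t => // k.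
    by rewrite leNgt; apply/negP => kt; apply: nk; exists k.
  (* If [t k 0 = 0], the trace bound forces [S k] to vanish on the range of [G], so this constraint
     cannot fail under the prior. *)
  have tgt : 0 < t k 0.
    rewrite lt_def t0 andbT; apply/eqP => teq.
    have [Fk FkE] := psdmx_factor (ellitope_psd ST k).
    have FG0 : Fk *m G = 0.
      apply: mxtrace_gram_eq0; apply/eqP; rewrite eq_le mxtrace_gram_ge0 andbT.
      have := trS k; rewrite teq mulr0 FkE; congr (_ <= _).
      by rewrite trmx_mul !mulmxA.
    move: kt; rewrite teq FkE -sqnorm2_mul mulmxA FG0 mul0mx sqnorm2E mulmx0 mxE.
    by rewrite ltxx.
  apply: (@le_trans _ _ (e1 k eta)%:E); last first.
    apply: (@le_trans _ _ (\sum_k (e1 k eta)%:E)%E).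
      rewrite (bigD1 k)//= leeDl//; apply: sume_ge0 => j _; by rewrite lee_fin.
    by rewrite leeDr// lee_fin sqr_ge0.
  rewrite -(integral_std_normal_cst m (e1 k eta)%:E).
  apply: ge0_le_integral.
  - exact: measurableT.
  - by move=> xi _; rewrite lee_fin sqnorm2_ge0.
  - exact: mint.
  - exact: measurable_cst.
  move=> xi _; rewrite lee_fin; apply: le_trans (sqnorm2B_le _ _) _.
  set b := sqnorm2 (B *m (G *m eta)).
  have b0 : 0 <= b by exact: sqnorm2_ge0.
  have w'M : sqnorm2 (w' (A *m (G *m eta) + sigma *: xi)) <= M ^+ 2.
    exact: sqnorm2_ball_proj_le.
  have bE : qform ((B *m G)^T *m (B *m G)) eta = b.
    by rewrite -sqnorm2_mul /b mulmxA.
  have SE : qform (G^T *m S k *m G) eta = qform (S k) (G *m eta).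
    by rewrite /qform trmx_mul !mulmxA.
  (* The loss is at most [2 M^2 (1 + b / M^2)]. If [M = 0], the trace bound gives [B G = 0] and the
     loss is 0. *)
  apply: (@le_trans _ _ (2 * M ^+ 2 * expR (M ^- 2 * b))).
    have [Meq|Mn] := eqVneq M 0.
      have : \tr ((B *m G)^T *m (B *m G)) = 0.
        apply/eqP; rewrite eq_le mxtrace_gram_ge0 andbT.
        by have := trB; rewrite Meq expr0n/= mulr0.
      move=> /mxtrace_gram_eq0 BG0.
      have b00 : b = 0 by rewrite /b mulmxA BG0 mul0mx sqnorm2E mulmx0 mxE.
      by move: w'M; rewrite b00 Meq expr0n/=; lra.
    have M20 : 0 < M ^+ 2 by rewrite exprn_gt0// lt_def Mn M0.
    have := expR_ge1Dx (M ^- 2 * b) => /(ler_wpM2l (ltW M20)).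
    rewrite mulrDr mulr1 mulrA divff ?gt_eqF// mul1r.
    by lra.
  rewrite /e1 -mulrA -[leRHS]mulrA -[leRHS]mulrA; apply: ler_wpM2l => //.
  rewrite ler_wpM2l ?sqr_ge0// -expRD ler_expR /W qformD !qformZ bE SE.
  suff : L <= L / t k 0 * qform (S k) (G *m eta) by lra.
  by rewrite mulrAC -mulrA ler_peMr ?ler_pdivlMr ?mul1r ?(ltW kt)//; lra.
apply: (@le_trans _ _ (\int[std_normal R n]_eta
   ((c ^+ 2)%:E + \sum_k (e1 k eta)%:E))%E).
  apply: ge0_le_integral.
  - exact: measurableT.
  - move=> eta _; apply: integral_ge0 => xi _; by rewrite lee_fin sqnorm2_ge0.
  - apply: (measurable_std_normal_section (F := fun ex : 'cV[R]_n * 'cV[R]_m =>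
      (sqnorm2 (w' (A *m (G *m ex.1) + sigma *: ex.2) - B *m (G *m ex.1)))%:E)).
      have mG : measurable_fun setT (fun ex : 'cV[R]_n * 'cV[R]_m => G *m ex.1).
        by apply: measurable_fun_mulmx; exact: measurable_fst.
      apply/measurable_EFinP; apply: measurable_fun_sqnorm2.
      apply: measurable_fun_addmx; last first.
        by apply: measurable_fun_oppmx; exact: measurable_fun_mulmx.
      apply: (measurableT_comp mw'); apply: measurable_fun_addmx.
        exact: measurable_fun_mulmx.
      apply: measurable_fun_scalemx; first exact: measurable_cst.
      exact: measurable_snd.
    by move=> ex; rewrite lee_fin sqnorm2_ge0.
  - apply: emeasurable_funD; first exact: measurable_cst.
    exact: emeasurable_sum.
  - by move=> eta _; exact: ptw.
rewrite ge0_integralD; first last.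
- exact: emeasurable_sum.
- by move=> eta _; apply: sume_ge0 => k _; rewrite lee_fin.
- exact: measurable_cst.
- by move=> eta _; rewrite lee_fin sqr_ge0.
- exact: measurableT.
rewrite integral_std_normal_cst EFinD; apply: leeD => //.
rewrite ge0_integral_sum; first last.
- by move=> k eta _; rewrite lee_fin.
- exact: me1.
- exact: measurableT.
apply: (@le_trans _ _ (\sum_(k < K) (2 * M ^+ 2 * expR (- L) * 2)%:E)%E).
  apply: lee_sum => k _; rewrite /e1.
  have cst0 : 0 <= 2 * M ^+ 2 * expR (- L).
    by rewrite !mulr_ge0 ?expR_ge0 ?sqr_ge0.
  under eq_integral do rewrite EFinM.
  rewrite ge0_integralZl; first last.
  - by rewrite lee_fin.
  - by move=> eta _; rewrite lee_fin expR_ge0.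
  - exact: mexp.
  - exact: measurableT.
  rewrite [leRHS]EFinM lee_wpmul2l ?lee_fin//.
  have trWk := trW k.
  apply: le_trans (std_normal_exp_qform (pW k) _) _; first by lra.
  (* [(1 - 2 * 3/8)^(-1/2) = 2]; with the factor 2 in [e1] this produces the constant 4. *)
  rewrite lee_fin; apply: invsqrt_le => //; lra.
rewrite sumEFin lee_fin sumr_const card_ord -[leLHS]mulr_natr.
by rewrite le_eqVlt; apply/orP; left; apply/eqP; ring.
Qed.

End optimality.

(** * From the Bayes risk to the minimax risk *)

Section near_optimality.
Context (R : realType) (m n nu K : nat).
Variables (A : 'M[R]_(m, n)) (B : 'M[R]_(nu, n)) (sigma : R).
Variables (S : 'I_K -> 'M[R]_n) (T : set 'cV[R]_K).
Hypothesis (sigma0 : 0 < sigma) (ST : ellitope_data S T).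
Local Notation X := (ellitope S T).
Local Notation M := (Mstar B S T).
Local Notation Ropt := (risk_opt A B sigma X).

Lemma risk_ge0 w : (0 <= risk A B sigma X w)%E.
Proof.
apply: le_trans (sqrte_ge0 _) _; apply: ereal_sup_ubound.
by exists 0; first exact: (ellitope0 ST).
Qed.

Lemma risk_opt_ge0 : (0 <= Ropt)%E.
Proof. by apply: le_ereal_inf_tmp => _ [w _ <-]; exact: risk_ge0. Qed.

(** Obtained from the zero estimate. It makes [Ropt] finite, so that [fine] loses nothing, and it
    makes the argument of the logarithm at least [8 K] when [Ropt > 0]. *)
Lemma risk_opt_le_Mstar : (Ropt <= M%:E)%E.
Proof.
apply: (@le_trans _ _ (risk A B sigma X (fun=> 0))).
  by apply: ereal_inf_lbound; exists (fun=> 0) => //=; exact: measurable_cst.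
apply: ge_ereal_sup => _ [x Xx <-]; rewrite unlock.
under eq_integral do rewrite sub0r sqnorm2N.
rewrite integral_std_normal_cst/= lee_fin -[leRHS]ger0_norm ?sqrtr_ge0//.
by rewrite -sqrtr_sqr; apply: ler_wsqrtr; exact: ellitope_Mstar.
Qed.

Lemma risk_opt_fin : Ropt \is a fin_num.
Proof.
rewrite fin_real// (lt_le_trans _ risk_opt_ge0) ?ltNy0//=.
by rewrite (le_lt_trans risk_opt_le_Mstar)// ltry.
Qed.

Lemma risk_le_mse w (c : R) : 0 <= c -> (risk A B sigma X w <= c%:E)%E ->
  forall x, X x -> (\int[std_normal R m]_xi
     (sqnorm2 (w (A *m x + sigma *: xi) - B *m x))%:E <= (c ^+ 2)%:E)%E.
Proof.
move=> c0 wc x Xx.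
have : (sqrte (\int[std_normal R m]_xi
     (sqnorm2 (w (A *m x + sigma *: xi) - B *m x))%:E) <= sqrte (c ^+ 2)%:E)%E.
  rewrite [leRHS]/= sqrtr_sqr ger0_norm//; apply: le_trans wc.
  by apply: ereal_sup_ubound; exists x => //; rewrite unlock.
by rewrite lee_sqrt// lee_fin sqr_ge0.
Qed.

(** The limit of [step], where [e] is the slack in the dual problem and [c] exceeds the risk of a
    nearly optimal estimate. *)
Lemma design_opt_le_exp (Opt L : R) :
  (forall p, design_feasible A B S p -> Opt <= design_objective sigma T p) ->
  2 <= L ->
  Opt / (4 * L) <= fine Ropt ^+ 2 + 4 * K%:R * M ^+ 2 * expR (- L).
Proof.
move=> Optle L2.
have L0 : 0 < 4 * L by lra.
have rho0 : 0 < (4 * L)^-1 by rewrite invr_gt0.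
have rho1 : (4 * L)^-1 <= 1 by rewrite invf_le1//; lra.
have r0 : 0 <= fine Ropt by exact: fine_ge0 risk_opt_ge0.
set r := fine Ropt in r0 *; set E := 4 * _ * _ * _.
have step c e : 0 < e -> r < c -> (Opt - e) / (4 * L) <= c ^+ 2 + E.
  move=> e0 rc; have c0 : 0 <= c by lra.
  have [Q QQ QOpt] := design_dual ST e0 Optle.
  have [_ [w mw <-] wc] : exists2 y,
      [set risk A B sigma X w | w in [set w | measurable_fun setT w]] y & (y < c%:E)%E.
    have cr0 : 0 < c - r by rewrite subr_gt0.
    have [y wy yc] := lb_ereal_inf_adherent cr0 risk_opt_fin.
    exists y => //; apply: lt_le_trans yc _.
    by rewrite -/Ropt -(fineK risk_opt_fin) -/r -EFinD lee_fin addrC subrK.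
  have [H HB] := bayes_risk_upper sigma0 ST mw c0 L2 QQ (risk_le_mse c0 (ltW wc)).
  (* Shrinking the covariance scales the bias term alone; since [(4 L)^-1 <= 1], the unscaled noise
     term still dominates its scaled version. *)
  apply: le_trans HB; apply: (@le_trans _ _ ((4 * L)^-1 * lin_risk2 A B sigma H Q)).
    by rewrite mulrC ler_wpM2l ?(ltW rho0)//.
  rewrite /lin_risk2 mulrDr -scalemxAr -scalemxAl mxtraceZ lerD2l mulrCA.
  by rewrite ler_wpM2l ?sqr_ge0// ler_piMl// mxtrace_gram_ge0.
rewrite -subr_le0 leNgt; apply/negP => gap.
set g := _ - _ in gap.
(* With [e = d] and [c = r + d], [d <= 1], the excess is at most [(2 r + 1) d + d], which is at most
   half the gap [g]. *)
pose d := Num.min 1 (g / (2 * (2 * r + 2))).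
have d0 : 0 < d by rewrite lt_min ltr01 divr_gt0//; lra.
have d1 : d <= 1 by rewrite ge_min lexx.
have dg : d * (2 * (2 * r + 2)) <= g.
  by rewrite -ler_pdivlMr ?ge_min ?lexx ?orbT//; lra.
have := step (r + d) d d0; rewrite ltrDl d0 => /(_ isT).
rewrite mulrBl => H.
have : d / (4 * L) <= d by rewrite ler_piMr// ltW.
have : g = Opt / (4 * L) - (r ^+ 2 + E) by [].
by nra.
Qed.

(** At [L = ln a] the bracket is [r^2 + r^2 / 2], and multiplying by [4 L] gives the factor 6. The
    requirement [2 <= L] holds because [a >= 8]. *)
Lemma design_opt_le_ln (Opt : R) :
  (forall p, design_feasible A B S p -> Opt <= design_objective sigma T p) ->
  0 <= Opt -> (0 < K)%N ->
  Opt <= 6 * ln (8 * M ^+ 2 * K%:R / fine Ropt ^+ 2) * fine Ropt ^+ 2.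
Proof.
move=> Optle Opt0 K0.
have r0 : 0 <= fine Ropt by exact: fine_ge0 risk_opt_ge0.
have rM : fine Ropt <= M.
  by rewrite -lee_fin fineK ?risk_opt_fin//; exact: risk_opt_le_Mstar.
have main := design_opt_le_exp Optle.
set r := fine Ropt in r0 rM main *.
have K1 : 1 <= K%:R :> R by rewrite ler1n.
have [req|rn] := eqVneq r 0.
  rewrite req expr0n/= mulr0 leNgt; apply/negP => Optgt.
  (* With [r = 0] the target is [Opt <= 0]. Since [expR (- L) <= 4 / L^2], the exponential bound
     yields [Opt * L <= c] for all [L >= 2], which fails at [L = 2 + c / Opt]. *)
  pose c := 64 * K%:R * M ^+ 2.
  have c0 : 0 <= c by rewrite mulr_ge0 ?sqr_ge0// mulr_ge0//; lra.
  pose L := 2 + c / Opt.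
  have cO : 0 <= c / Opt by rewrite divr_ge0.
  have L2 : 2 <= L by rewrite /L; lra.
  have := main L L2; rewrite req expr0n/= add0r.
  rewrite ler_pdivrMr; last by lra.
  have eL : expR (- L) * L ^+ 2 <= 4.
    rewrite expRN mulrC ler_pdivrMr ?expR_gt0//.
    have -> : expR L = expR (L / 2) ^+ 2 by rewrite -expRM_natl; congr expR; field.
    have := expR_ge1Dx (L / 2); set e := expR _ => eL.
    by nra.
  have -> : 4 * K%:R * M ^+ 2 * expR (- L) * (4 * L) = c / 4 * (expR (- L) * L).
    by rewrite /c; field.
  have LL : expR (- L) * L <= 4 / L.
    by rewrite ler_pdivlMr; [rewrite -mulrA -expr2|lra].
  have c40 : 0 <= c / 4 by lra.
  have := ler_wpM2l c40 LL.
  move=> h1 h2; have : Opt * L <= c.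
    rewrite -ler_pdivlMr; last by lra.
    rewrite (_ : c / L = c / 4 * (4 / L)); first exact: le_trans h2 h1.
    by field; rewrite gt_eqF//; lra.
  rewrite /L mulrDr mulrCA divff ?gt_eqF// mulr1; lra.
have rgt : 0 < r by rewrite lt_def rn r0.
have r20 : 0 < r ^+ 2 by rewrite exprn_gt0.
have Mr : r ^+ 2 <= M ^+ 2 by rewrite lerXn2r ?nnegrE// (le_trans r0).
set a := 8 * M ^+ 2 * K%:R / r ^+ 2.
have a8 : 8 <= a.
  rewrite /a ler_pdivlMr// -mulrA ler_wpM2l// (le_trans Mr)//.
  by rewrite ler_peMr// sqr_ge0.
have agt : 0 < a by lra.
have L2 : 2 <= ln a.
  rewrite -[leLHS]expRK ler_ln ?posrE ?expR_gt0//.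
  by apply: le_trans a8; exact: expR2_le8.
have := main _ L2; rewrite expRN lnK ?posrE//.
have -> : 4 * K%:R * M ^+ 2 * a^-1 = r ^+ 2 / 2.
  have Mn : M != 0 by rewrite gt_eqF// (lt_le_trans rgt).
  have Kn : K%:R != 0 :> R by rewrite gt_eqF//; lra.
  by rewrite /a; field; rewrite ?Mn ?Kn ?rn.
rewrite ler_pdivrMr; last by lra.
by lra.
Qed.

End near_optimality.

Theorem theorem2p1 (R : realType) (m n nu K : nat)
  (A : 'M[R]_(m, n)) (B : 'M[R]_(nu, n)) (sigma : R)
  (S : 'I_K -> 'M[R]_n) (T : set 'cV[R]_K)
  (Hstar : 'M[R]_(m, nu)) (lambda_star : 'cV[R]_K) :
  B != 0 ->
  0 < sigma ->
  ellitope_data S T ->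
  design_optimal A B sigma S T (Hstar, lambda_star) ->
  let X := ellitope S T in
  let Opt := design_opt A B sigma S T in
  let Ropt := risk_opt A B sigma X in
  (risk A B sigma X (linear_estimate Hstar) <= (Num.sqrt Opt)%:E)%E /\
  ((Num.sqrt Opt)%:E <=
     (Num.sqrt (6 * ln (8 * Mstar B S T ^+ 2 * K%:R / fine Ropt ^+ 2)))%:E
     * Ropt)%E.
Proof.
move=> B0 sigma0 ST [feas opt] X Opt Ropt.
have OptE : Opt = design_objective sigma T (Hstar, lambda_star).
  apply/eqP; rewrite eq_le; apply/andP; split.
    apply: ge_inf; last by exists (Hstar, lambda_star).
    by exists (design_objective sigma T (Hstar, lambda_star)) => _ [q fq <-]; exact: opt.
  apply: lb_le_inf; first by exists (design_objective sigma T (Hstar, lambda_star)), (Hstar, lambda_star).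
  by move=> _ [q fq <-]; exact: opt.
split; first by rewrite OptE; exact: risk_linear_le.
have Opt0 : 0 <= Opt.
  rewrite OptE addr_ge0//; first by rewrite mulr_ge0 ?sqr_ge0 ?mxtrace_gram_ge0.
  by apply: (support_fun_ge0 ST); case: feas.
(* With [K = 0] the empty sum 0 would be positive definite, which forces [n = 0] and hence
   [B = 0]. *)
have K0 : (0 < K)%N.
  rewrite lt0n; apply: contra B0 => /eqP K0; subst K.
  have [_ pd] := ellitope_pd ST.
  apply/eqP/matrixP => i j; have := pd (delta_mx j 0).
  rewrite big_ord0 mulmx0 mul0mx mxE ltxx => H; exfalso.
  have : (delta_mx j 0 : 'cV[R]_n) != 0.
    apply/eqP => /matrixP/(_ j 0); rewrite !mxE !eqxx; apply/eqP; exact: oner_neq0.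
  by move=> /H.
have optle p : design_feasible A B S p -> Opt <= design_objective sigma T p.
  by rewrite OptE; exact: opt.
have r0 : 0 <= fine Ropt by exact: fine_ge0 (risk_opt_ge0 _ _ _ ST).
have RoptE : Ropt = (fine Ropt)%:E by rewrite fineK//; exact: risk_opt_fin.
have final := design_opt_le_ln sigma0 ST optle Opt0 K0.
rewrite -/X -/Ropt in final.
set r := fine Ropt in r0 RoptE final *; set a := 6 * _ in final *.
rewrite RoptE -EFinM lee_fin.
have -> : Num.sqrt a * r = Num.sqrt (r ^+ 2 * a).
  by rewrite [RHS]sqrtrM ?sqr_ge0// sqrtr_sqr ger0_norm// mulrC.
by apply: ler_wsqrtr; rewrite mulrC.
Qed.
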